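(* Let $n\ge 1$ and $1\le m\le n$ be integers, and let $0<R_1<R_2<\infty$. Model hyperbolic space $\mathbb{R}^{n+1}(-1)$ as $S^n\times[0,\infty)$ with metric $h=d\rho^2+\sinh^2\rho\, e$, where $e$ is the standard round metric on the unit sphere $S^n$, and let $\bar\Omega=\{(u,\rho): u\in S^n,\ \rho\in[R_1,R_2]\}$. Let $\psi(u,\rho)$ be a positive smooth function on $\bar\Omega$ satisfying $$\frac{\partial}{\partial\rho}\left[\psi(u,\rho)\sinh^m\rho\right]\le 0\quad\text{for all } u\in S^n,\ \rho\in[R_1,R_2].$$ Let $z_1,z_2\in C^2(S^n)$ be $m$-admissible functions with $R_1\le z_k(u)\le R_2$ for all $u\in S^n$, $k=1,2$, each solving $$H_m(\lambda(z_k(u)))=\psi(u,z_k(u))\quad\text{for all } u\in S^n.$$ Then there is a positive constant $c$ such that $$c\tanh\!\left(\tfrac{z_1(u)}{2}\right)=\tanh\!\left(\tfrac{z_2(u)}{2}\right)\quad\text{for all } u\in S^n.$$ If moreover the inequality $\frac{\partial}{\partial\rho}[\psi(u,\rho)\sinh^m\rho]<0$ holds strictly on $\bar\Omega$, then $c=1$, i.e. $z_1\equiv z_2$.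
   Context: For a positive function $z\in C^2(S^n)$, $M_z=\{(u,z(u)):u\in S^n\}$ is the radial graph of $z$. Its principal curvatures $\lambda(z(u))=(\lambda_1,\dots,\lambda_n)$ at $(u,z(u))$ are computed with respect to the inner normal (pointing toward decreasing $\rho$; with this convention geodesic spheres $\rho=\text{const}$ have positive principal curvatures). For $\lambda\in\mathbb{R}^n$, $S_m(\lambda)=\sum_{i_1<\dots<i_m}\lambda_{i_1}\cdots\lambda_{i_m}$ and $H_m(\lambda)=\binom{n}{m}^{-1}S_m(\lambda)$ is the $m$-th mean curvature. $\Gamma_m$ denotes the connected component of $\{\lambda\in\mathbb{R}^n: H_m(\lambda)>0\}$ containing the positive cone $\{\lambda:\lambda_1,\dots,\lambda_n>0\}$. A positive $z\in C^2(S^n)$ is $m$-admissible if $\lambda(z(u))\in\Gamma_m$ for every $u\in S^n$. *)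

(* Defs.v *)
From HB Require Import structures.
From mathcomp Require Import all_boot all_order all_algebra.
From mathcomp Require Import all_classical all_reals all_analysis.
Set Implicit Arguments. Unset Strict Implicit. Unset Printing Implicit Defensive.
Import Order.TTheory GRing.Theory Num.Theory.
Import numFieldNormedType.Exports.
Local Open Scope classical_set_scope.
Local Open Scope ring_scope.

Section Defs.
Variable R : realType.

Definition sinh (x : R) : R := (expR x - expR (- x)) / 2.
Definition cosh (x : R) : R := (expR x + expR (- x)) / 2.
Definition tanh (x : R) : R := sinh x / cosh x.

Definition edot k (x y : 'rV[R]_k) : R := \sum_(i < k) x 0 i * y 0 i.
Definition enorm k (x : 'rV[R]_k) : R := Num.sqrt (edot x x).

Definition sphere k : set 'rV[R]_k := [set u | edot u u = 1].

Definition ebase k (i : 'I_k) : 'rV[R]_k := delta_mx 0 i.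

Fixpoint iter_partial k (s : seq 'I_k) (F : 'rV[R]_k -> R) : 'rV[R]_k -> R :=
  match s with
  | [::] => F
  | i :: s' => fun x => derive (iter_partial s' F) x (ebase i)
  end.

Definition Ck_on k (N : nat) (U : set 'rV[R]_k) (F : 'rV[R]_k -> R) : Prop :=
  open U /\
  forall s : seq 'I_k, (size s <= N)%N ->
    (forall x, U x -> continuous_at x (iter_partial s F)) /\
    ((size s < N)%N -> forall x, U x -> forall i,
        derivable (iter_partial s F) x (ebase i)).

Definition smooth_on k (U : set 'rV[R]_k) (F : 'rV[R]_k -> R) : Prop :=
  forall N, Ck_on N U F.

Definition hext k (z : 'rV[R]_k -> R) : 'rV[R]_k -> R :=
  fun x => z ((enorm x)^-1 *: x).

Definition C2_sphere k (z : 'rV[R]_k -> R) : Prop :=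
  Ck_on 2 [set x | x != 0] (hext z).

(* Euclidean gradient and Hessian (of the homogeneous extension) at u;
   at u in S^n these are the spherical gradient and covariant Hessian *)
Definition sgrad k (z : 'rV[R]_k -> R) (u : 'rV[R]_k) : 'rV[R]_k :=
  \row_(i < k) derive (hext z) u (ebase i).
Definition shess k (z : 'rV[R]_k -> R) (u : 'rV[R]_k) : 'M[R]_k :=
  \matrix_(i < k, j < k) derive (fun y => derive (hext z) y (ebase i)) u (ebase j).

(* first and second fundamental forms of the radial graph
   M_z = {(u, z u)} in (S^n x [0,oo), d rho^2 + sinh^2 rho e), written as
   bilinear forms on the tangent space T_u S^n = u^perp (extended by zero on u):
     g = sinh^2 z P + Dz^T Dz,
     h = ( - sinh z P D^2z P + 2 cosh z Dz^T Dz + sinh^2 z cosh z P ) / w,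
   w = sqrt(sinh^2 z + |Dz|^2), P = I - u^T u; h w.r.t. the inner normal. *)
Definition tproj k (u : 'rV[R]_k) : 'M[R]_k := 1%:M - u^T *m u.

Definition fund1 k (z : 'rV[R]_k -> R) (u : 'rV[R]_k) : 'M[R]_k :=
  (sinh (z u) ^+ 2) *: tproj u + (sgrad z u)^T *m sgrad z u.

Definition fund2 k (z : 'rV[R]_k -> R) (u : 'rV[R]_k) : 'M[R]_k :=
  let w := Num.sqrt (sinh (z u) ^+ 2 + edot (sgrad z u) (sgrad z u)) in
  w^-1 *: ( - (sinh (z u) *: (tproj u *m shess z u *m tproj u))
            + (2 * cosh (z u)) *: ((sgrad z u)^T *m sgrad z u)
            + (sinh (z u) ^+ 2 * cosh (z u)) *: tproj u).

(* lam (an n-tuple) lists the principal curvatures of M_z at (u, z u) with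
   multiplicity, i.e. the eigenvalues of g^{-1} h on T_u S^n.  With
   G = g + u^T u (block diag (g_T, 1)) this says
   det(G) * X * prod_i (X - lam_i) = det(X G - h). *)
Definition principal_curvatures n (z : 'rV[R]_n.+1 -> R) (u : 'rV[R]_n.+1)
    (lam : 'rV[R]_n) : Prop :=
  let G := fund1 z u + u^T *m u in
  let H := fund2 z u in
  (\det G) *: ('X * \prod_(i < n) ('X - (lam 0 i)%:P))
  = \det (\matrix_(i < n.+1, j < n.+1) (G i j *: 'X - (H i j)%:P)).

Definition sigma_m n (m : nat) (lam : 'rV[R]_n) : R :=
  \sum_(A : {set 'I_n} | #|A| == m) \prod_(i in A) lam 0 i.
Definition Hm n (m : nat) (lam : 'rV[R]_n) : R := sigma_m m lam / ('C(n, m))%:R.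

(* Gamma_m: connected component of {H_m > 0} containing the positive cone
   (we take the component of the point (1,...,1) of the positive cone) *)
Definition Gamma_m n (m : nat) : set 'rV[R]_n :=
  connected_component [set lam | 0 < Hm m lam] (const_mx 1).

Definition m_admissible n (m : nat) (z : 'rV[R]_n.+1 -> R) : Prop :=
  (forall u, sphere u -> 0 < z u) /\
  forall u, sphere u -> forall lam, principal_curvatures z u lam ->
    Gamma_m m lam.

Definition Omega_bar n (R1 R2 : R) : set 'rV[R]_(n.+1 + 1) :=
  [set p | exists u r, [/\ sphere u, R1 <= r <= R2 & p = row_mx u (const_mx r)]].

End Defs.

(* Main.v *)
Require Import Defs.
From HB Require Import structures.
From mathcomp Require Import all_boot all_order all_algebra.
From mathcomp Require Import all_classical all_reals all_analysis.
From mathcomp Require Import ring lra zify.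
From mathcomp.real_closed Require Import complex.
Import Order.TTheory GRing.Theory Num.Theory.
Import numFieldNormedType.Exports.
Set Implicit Arguments. Unset Strict Implicit. Unset Printing Implicit Defensive.
Local Open Scope classical_set_scope.
Local Open Scope ring_scope.

(* Put [v = ln (tanh (z / 2))]. In this coordinate the curvature matrix of [M_z]
   is [(cosh z - (1 + Dv Dv^T)^-1 D^2v) / (sinh z * sqrt (1 + |Dv|^2))], so the
   equation reads [H_m (cosh z - (1 + Dv Dv^T)^-1 D^2v) = sqrt (1 + |Dv|^2) ^ m
   * psi * sinh^m z], where the right-hand side is nonincreasing in [z] and
   the matrix on the left is strictly increasing in [z]. If [z1 > z2] somewhere,
   then at a maximum of [v1 - v2] the gradients agree and [D^2v1 <= D^2v2], so
   monotonicity of [H_m] on [Gamma_m] contradicts the monotonicity of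
   [psi sinh^m]. Hence [z1 = z2] already under the weak inequality, and [c = 1]
   always works.

   Monotonicity of [H_m] is reduced to rank-one perturbations [M + w^* w] of a
   Hermitian matrix with eigenvalues [l_i]: these add [sum_i |w_i|^2 S_(m-1)(l
   without l_i)] to [S_m], and these coefficients are positive by Newton's
   inequalities, which also identify [Gamma_m] with [S_1, ..., S_m > 0]. *)

(** * Newton inequalities for elementary symmetric functions *)

Section RealRooted.
Variable C : numClosedFieldType.
Implicit Types (p : {poly C}) (s : seq C).

(** Allowing [c = 0] keeps the class stable under differentiation. *)
Definition real_rooted p : Prop :=
  exists (c : C) (s : seq C), [/\ c \is Num.real, all (mem Num.real) s &
    p = c *: \prod_(x <- s) ('X - x%:P)].

Lemma prod_root_nonreal s (t : C) : all (mem Num.real) s -> t \isn't Num.real ->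
  (\prod_(x <- s) ('X - x%:P)).[t] != 0.
Proof.
move=> sR tNR; apply/negP => rt.
have : root (\prod_(x <- s) ('X - x%:P)) t by [].
by rewrite root_prod_XsubC => /(allP sR); apply/negP.
Qed.

Lemma coef_prod_real s : all (mem Num.real) s ->
  forall i, (\prod_(x <- s) ('X - x%:P))`_i \is Num.real.
Proof.
elim: s => [|x s IH] /=; first by move=> _ i; rewrite big_nil coef1 realn.
case/andP=> xR /IH sR i.
rewrite big_cons mulrBl coefB coefXM coefCM.
by apply: rpredB; [case: ifP => _; rewrite ?rpred0|apply: rpredM].
Qed.

(* Gauss-Lucas: for a product of real linear factors, [p'/p] maps the upper
   half plane to the lower one. *)
Lemma Im_logderiv_lt0 s (t : C) : all (mem Num.real) s -> t \isn't Num.real ->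
  let p := \prod_(x <- s) ('X - x%:P) in
  ('Im t * 'Im (p^`().[t] / p.[t]) <= 0) /\
  (s != [::] -> 'Im t * 'Im (p^`().[t] / p.[t]) < 0).
Proof.
move=> sR tNR /=; elim: s sR => [|x s IH] sR.
  by rewrite big_nil derivC horner0 mul0r raddf0 mulr0.
have /andP[xR /[dup] s'R /IH [le0 _]] := sR.
suff lt0 : 'Im t * 'Im ((\prod_(x0 <- x :: s) ('X - x0%:P))^`().[t] /
   (\prod_(x0 <- x :: s) ('X - x0%:P)).[t]) < 0 by split => [|_] //; exact: ltW.
rewrite big_cons derivM derivXsubC mul1r hornerD !hornerM hornerXsubC.
set p := \prod_(_ <- s) _ in le0 *.
have p0 : p.[t] != 0 by exact: prod_root_nonreal.
have tx0 : t - x != 0.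
  by apply: contraNneq tNR => /subr0_eq ->.
have -> : (p.[t] + (t - x) * p^`().[t]) / ((t - x) * p.[t]) =
   (t - x)^-1 + p^`().[t] / p.[t] by field; rewrite p0 tx0.
rewrite raddfD mulrDr /=; apply: ltr_wnDr => //.
(* The new summand [(t - x)^-1] has imaginary part [- 'Im t / |t - x|^2]. *)
rewrite invC_norm ImMl ?rpredV ?rpredX ?normr_real // Im_conj mulrN mulrN oppr_lt0.
rewrite raddfB /= (Creal_ImP x xR) subr0 mulrCA mulr_gt0 //.
  by rewrite invr_gt0 exprn_gt0 // normr_gt0.
rewrite -expr2 real_exprn_even_gt0 //= ?Creal_Im //.
by apply: contraNneq tNR => /Creal_ImP.
Qed.

(** The derivative splits over a closed field; at a nonreal root of it the logarithmic derivative
    would vanish, which Gauss-Lucas excludes. *)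
Lemma real_rooted_deriv p : real_rooted p -> real_rooted p^`().
Proof.
case=> c [s [cR sR ->]].
have [->|c0] := eqVneq c 0.
  rewrite scale0r deriv0; exists 0, [::]; split => //.
  by rewrite scale0r.
have [->|s0] := eqVneq s [::].
  rewrite big_nil -mul_polyC mulr1 derivC; exists 0, [::]; split => //.
  by rewrite scale0r.
set q := \prod_(x <- s) _.
have [r rE] := closed_field_poly_normal (c *: q)^`().
exists (lead_coef (c *: q)^`()), r; split => //.
  by rewrite /lead_coef coef_deriv coefZ rpredMn // rpredM // coef_prod_real.
apply/allP => z zr; apply: contraT => zNR.
have : (c *: q)^`().[z] = 0.
  apply/rootP; rewrite rE /root hornerZ mulf_eq0; apply/orP; right.
  by rewrite -/(root _ _) root_prod_XsubC.
rewrite derivZ hornerZ => /eqP; rewrite mulf_eq0 (negPf c0) /= => /eqP q'z.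
have [_ /(_ s0)] := Im_logderiv_lt0 sR zNR.
by rewrite q'z mul0r raddf0 mulr0 ltxx.
Qed.

Lemma real_rooted_derivn p n : real_rooted p -> real_rooted p^`(n).
Proof. by move=> pR; elim: n => // n IH; rewrite derivnS; apply: real_rooted_deriv. Qed.

(** Laguerre's inequality. A new factor [X - r] turns [q'^2 - q q''] into
    [q^2 + (x - r)^2 (q'^2 - q q'')], so nonnegativity is inherited. *)
Lemma laguerre p (x : C) : real_rooted p -> x \is Num.real ->
  p.[x] * p^`()^`().[x] <= p^`().[x] ^+ 2.
Proof.
case=> c [s [cR sR ->]] xR.
rewrite !derivZ !hornerZ exprMn mulrACA -expr2.
apply: ler_wpM2l; first exact: real_exprn_even_ge0.
elim: s sR => [|r s IH] /=; first by rewrite big_nil !derivC !horner0 mulr0 expr0n.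
case/andP=> rR /[dup] sR /IH; rewrite big_cons.
set q := \prod_(_ <- s) _ => le.
have qR : q.[x] \is Num.real.
  rewrite horner_coef; apply: rpred_sum => i _.
  by rewrite rpredM ?rpredX // coef_prod_real.
rewrite derivM derivXsubC mul1r derivD derivM derivXsubC mul1r.
rewrite !(hornerM, hornerD _ (_ * _), hornerD q^`(), hornerXsubC).
rewrite -subr_ge0.
have -> : (q.[x] + (x - r) * q^`().[x]) ^+ 2 -
   (x - r) * q.[x] * (q^`().[x] + (q^`().[x] + (x - r) * q^`()^`().[x])) =
   q.[x] ^+ 2 + (x - r) ^+ 2 * (q^`().[x] ^+ 2 - q.[x] * q^`()^`().[x]) by ring.
apply: addr_ge0; first exact: real_exprn_even_ge0.
by apply: mulr_ge0; [apply: real_exprn_even_ge0; rewrite ?rpredB|rewrite subr_ge0].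
Qed.

Lemma real_rooted_prod1 s : all (mem Num.real) s ->
  real_rooted (\prod_(x <- s) (1 + x *: 'X)).
Proof.
elim: s => [|a s IH] /=.
  move=> _; exists 1, [::]; split => //.
  by rewrite !big_nil scale1r.
case/andP=> aR /IH [c [r [cR rR E]]]; rewrite big_cons E.
have [->|a0] := eqVneq a 0.
  by exists c, r; split => //; rewrite scale0r addr0 mul1r.
exists (c * a), (- a^-1 :: r); split; first exact: rpredM.
  by rewrite /= rR andbT rpredN rpredV.
rewrite big_cons polyCN opprK -!mul_polyC polyCM.
have : a%:P * (a^-1)%:P = 1 :> {poly C} by rewrite -polyCM divff.
move: (\prod_(_ <- _) _) (a^-1)%:P => q b ab.
transitivity (a%:P * b * (c%:P * q) + a%:P * 'X * (c%:P * q)); last by ring.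
by rewrite ab; ring.
Qed.

End RealRooted.

(** * Elementary symmetric functions, read off the generating polynomial *)

Definition elem_sym (K : comNzRingType) (s : seq K) (j : nat) : K :=
  (\prod_(x <- s) (1 + x *: 'X))`_j.

Section Esym.
Variable K : comNzRingType.
Implicit Types (s : seq K).

Lemma elem_sym0 s : elem_sym s 0 = 1.
Proof.
rewrite /elem_sym -horner_coef0 horner_prod big1 // => x _.
by rewrite hornerD hornerZ hornerX mulr0 hornerC addr0.
Qed.

Lemma elem_sym_consS x s j : elem_sym (x :: s) j.+1 = elem_sym s j.+1 + x * elem_sym s j.
Proof. by rewrite /elem_sym big_cons mulrDl mul1r coefD -scalerAl coefZ coefXM. Qed.

Lemma perm_elem_sym s t j : perm_eq s t -> elem_sym s j = elem_sym t j.
Proof. by move=> st; rewrite /elem_sym (perm_big _ st). Qed.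

Lemma elem_sym_scale a s j : elem_sym [seq a * x | x <- s] j = a ^+ j * elem_sym s j.
Proof.
elim: s j => [|x s IH] [|j] /=; rewrite ?elem_sym0 ?mulr1 //.
  by rewrite /elem_sym !big_nil coef1 mulr0.
by rewrite !elem_sym_consS !IH exprS; ring.
Qed.

End Esym.

Lemma map_elem_sym (K L : comNzRingType) (f : {rmorphism K -> L}) s j :
  elem_sym (map f s) j = f (elem_sym s j).
Proof.
elim: s j => [|x s IH] [|j] /=; rewrite ?elem_sym0 ?rmorph1 //.
  by rewrite /elem_sym !big_nil !coef1 /= (rmorph0 f).
by rewrite !elem_sym_consS !IH rmorphD rmorphM.
Qed.

(** Laguerre's inequality at 0 for the [j]-th derivative of the generating polynomial: up to
    factorials, its value and those of the next two derivatives are the coefficients [j], [j+1],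
    [j+2]. *)
Lemma newton (R : rcfType) (s : seq R) j :
  elem_sym s j * elem_sym s j.+2 <= elem_sym s j.+1 ^+ 2.
Proof.
pose f := real_complex R.
have sR : all (mem Num.real) (map f s).
  apply/allP => _ /mapP[x _ ->]; apply/orP.
  by rewrite (_ : 0 = f 0) ?rmorph0 // !lecR; apply/orP/le_total.
have := laguerre (real_rooted_derivn j (real_rooted_prod1 sR)) (rpred0 _).
set p := \prod_(_ <- _) _.
rewrite -!derivnS !horner_coef0 !coef_derivn !addn0 !ffactnn.
rewrite -!/(elem_sym _ _) !map_elem_sym -!rmorphMn /= -rmorphM -rmorphXn lecR.
(* When the left side is positive, Laguerre gives the bound with an extra factor [(j+2)/(j+1)] on
   the left, which may be dropped. *)
have [neg _|pos] := lerP (elem_sym s j * elem_sym s j.+2) 0.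
  exact: le_trans neg (sqr_ge0 _).
move: (elem_sym s j) (elem_sym s j.+1) (elem_sym s j.+2) pos => a b c pos.
rewrite exprMn_n mulrnAr mulrnAl -mulrnA => le.
have g0 : (0 < j.+1`! ^ 2)%N by rewrite expn_gt0 fact_gt0.
rewrite -(ler_pMn2r g0); apply: le_trans le.
apply: ler_wpMn2l; first exact: ltW.
rewrite !factS (_ : (j`! * _ = j.+2 * j.+1 * j`! ^ 2)%N); last by ring.
by rewrite expnMn leq_mul2r -mulnn leq_mul2r leqnSn !orbT.
Qed.

(** Let [a, b, c] be consecutive functions of [s] with [a > 0] and, for contradiction, [b <= 0].
    Positivity for [x :: s] gives [b + x a > 0] and [c + x b > 0], hence [x > 0] and [a c > b^2],
    against Newton. *)
Lemma elem_sym_rem_gt0 (R : rcfType) (x : R) (s : seq R) m :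
  (forall j, (j <= m)%N -> 0 < elem_sym (x :: s) j) ->
  forall j, (j < m)%N -> 0 < elem_sym s j.
Proof.
move=> pos; elim=> [|j IH] jm; first by rewrite elem_sym0.
have aj := IH (ltnW jm).
rewrite ltNge; apply/negP => a1.
have := pos _ (ltnW jm); have := pos _ jm; rewrite !elem_sym_consS.
have := newton s j.
move: (elem_sym s j) (elem_sym s j.+1) (elem_sym s j.+2) aj a1 => a b c a0 b0 N p1 p2.
have xa : 0 < x * a by lra.
have x0 : 0 < x by move: xa; rewrite pmulr_lgt0.
have c0 : x * (- b) < c by lra.
have le1 : x * a * (x * - b) <= x * a * c by rewrite ler_pM2l // ltW.
have le2 : x * a * c <= x * b ^+ 2.
  by rewrite -mulrA ler_pM2l.
have lt3 : - b < x * a by lra.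
have := le_trans le1 le2.
rewrite (_ : x * a * (x * - b) = x * (x * a * - b)) ?ler_pM2l //; last by ring.
have [b0'|bn] := eqVneq b 0.
  have ac : 0 < a * c.
    by rewrite mulr_gt0 //; move: c0; rewrite b0' oppr0 mulr0.
  by have := lt_le_trans ac N; rewrite b0' expr0n ltxx.
have nb : 0 < - b by lra.
rewrite -sqrrN expr2 ler_pM2r //; lra.
Qed.

(** * Hermitian matrices *)

(** The matrix determinant lemma, from two evaluations of the bordered matrix [B]. *)
Lemma det_diag_rank1 (K : idomainType) k (a r : 'rV[K]_k) (c : 'cV[K]_k) :
  (forall i, a 0 i != 0) ->
  \det (diag_mx a + c *m r) =
  \prod_i a 0 i + \sum_i r 0 i * c i 0 * \prod_(j | j != i) a 0 j.
Proof.
move=> a0; pose B := block_mx 1%:M (- r) c (diag_mx a).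
have detB : \det B = \det (diag_mx a + c *m r).
  rewrite (_ : B = block_mx 1%:M 0 c 1%:M *m
    block_mx 1%:M (- r) 0 (diag_mx a + c *m r)).
    by rewrite det_mulmx det_lblock det_ublock !det1 !mul1r.
  rewrite mulmx_block !(mul1mx, mulmx1, mul0mx, mulmx0, addr0).
  by rewrite mulmxN [diag_mx a + _]addrC addKr.
pose b : 'rV[K]_k := \row_i \prod_(j | j != i) a 0 j.
pose s := \sum_i r 0 i * c i 0 * b 0 i.
have ab i : (\prod_(j | j != i) a 0 j) * a 0 i = \prod_j a 0 j.
  by rewrite [RHS](bigD1 i) //= mulrC.
have : \det B * \prod_i a 0 i = (\prod_i a 0 i + s) * \prod_i a 0 i.
  (* Elimination in [B] uses the cofactor products [b] instead of the inverse of [diag_mx a]. No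
     division occurs, so the entries may be polynomials; the extra factor is cancelled at the
     end. *)
  have -> : \prod_i a 0 i = \det (block_mx (\prod_i a 0 i)%:M 0
      (- (diag_mx b *m c)) (1%:M : 'M[K]_k)).
    by rewrite det_lblock det1 mulr1 det_scalar1.
  rewrite -det_mulmx mulmx_block !(mul1mx, mulmx1, mulmx0, add0r).
  rewrite mulNmx !mulmxN opprK.
  have -> : c *m (\prod_i a 0 i)%:M - diag_mx a *m (diag_mx b *m c) = 0.
    rewrite mulmxA mulmx_diag; apply/matrixP => i j.
    by rewrite !ord1 mul_mx_scalar mul_diag_mx !mxE -(ab i); ring.
  rewrite det_ublock det_diag det_lblock det1 mulr1 det_scalar1; congr (_ * _).
  rewrite det_mx11 !mxE; congr (_ + _).
  by apply: eq_bigr => i _; rewrite mul_diag_mx !mxE; ring.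
rewrite detB => /mulIf ->; last by apply/prodf_neq0.
by congr (_ + _); apply: eq_bigr => i _; rewrite mxE.
Qed.

(** The [j]-th elementary symmetric function of the eigenvalues of [M], without reference to
    eigenvalues. *)
Definition ecoef (K : comNzRingType) k (M : 'M[K]_k) (j : nat) : K :=
  (\det (1%:M + 'X *: map_mx polyC M))`_j.

Lemma map_ecoef (K L : comNzRingType) (f : {rmorphism K -> L}) k (M : 'M[K]_k) j :
  ecoef (map_mx f M) j = f (ecoef M j).
Proof.
rewrite /ecoef -coef_map -det_map_mx; congr (polyseq _)`_j.
congr (\det _).
apply/matrixP => a b; rewrite !mxE rmorphD rmorphM /= map_polyX map_polyC /=.
by rewrite rmorphMn rmorph1.
Qed.

Lemma ecoef0 (K : comNzRingType) k (M : 'M[K]_k) : ecoef M 0 = 1.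
Proof.
rewrite /ecoef -horner_coef0 -horner_evalE -det_map_mx.
rewrite (_ : map_mx _ _ = 1%:M) ?det1 //; apply/matrixP => a b.
rewrite !mxE /= /horner_eval hornerD hornerM hornerX mul0r addr0.
by case: eqP => _; rewrite ?hornerC ?horner0.
Qed.

Lemma ecoef_conj (K : comNzRingType) k (P Q M : 'M[K]_k) j :
  P *m Q = 1%:M -> ecoef (P *m M *m Q) j = ecoef M j.
Proof.
move=> PQ; rewrite /ecoef; congr (polyseq _)`_j.
have PQ' : map_mx polyC P *m map_mx polyC Q = 1%:M by rewrite -map_mxM PQ map_mx1.
rewrite !map_mxM scalemxAl scalemxAr -[in LHS]PQ' -[X in X *m _ + _]mulmx1.
rewrite -mulmxDl -mulmxDr !det_mulmx mulrAC -det_mulmx PQ' det1 mul1r //.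
Qed.

Lemma char_poly_conj (K : comNzRingType) k (P Q M : 'M[K]_k) :
  P *m Q = 1%:M -> char_poly (P *m M *m Q) = char_poly M.
Proof.
move=> PQ; rewrite /char_poly /char_poly_mx.
have PQ' : map_mx polyC P *m map_mx polyC Q = 1%:M by rewrite -map_mxM PQ map_mx1.
have -> : 'X%:M = map_mx polyC P *m 'X%:M *m map_mx polyC Q.
  by rewrite mul_mx_scalar -scalemxAl PQ' scalemx1.
rewrite !map_mxM -mulmxBl -mulmxBr !det_mulmx mulrAC -det_mulmx PQ' det1 mul1r.
by rewrite mul_mx_scalar -scalemxAl PQ' scalemx1.
Qed.

Definition row_seq (K : Type) k (l : 'rV[K]_k) : seq K := [seq l 0 i | i <- enum 'I_k].


Lemma ecoef_diag (K : comNzRingType) k (l : 'rV[K]_k) j :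
  ecoef (diag_mx l) j = elem_sym (row_seq l) j.
Proof.
rewrite /ecoef /elem_sym big_map big_enum /= map_diag_mx -diag_const_mx.
rewrite -linearZ -linearD det_diag; congr (polyseq _)`_j.
apply: eq_big => // i _.
by rewrite !mxE -!mul_polyC mulrC.
Qed.

Definition row_rem (K : Type) k (l : 'rV[K]_k) (i : 'I_k) : seq K :=
  [seq l 0 a | a <- enum 'I_k & a != i].

Lemma perm_row_rem (K : eqType) k (l : 'rV[K]_k) (i : 'I_k) :
  perm_eq (row_seq l) (l 0 i :: row_rem l i).
Proof.
rewrite /row_seq /row_rem -(map_cons (l 0)); apply: perm_map.
rewrite -rem_filter ?enum_uniq //; apply: perm_to_rem; exact: mem_enum.
Qed.

Lemma map_row_rem (K L : Type) (f : K -> L) k (l : 'rV[K]_k) i :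
  row_rem (map_mx f l) i = map f (row_rem l i).
Proof. by rewrite /row_rem -map_comp; apply: eq_map => a /=; rewrite mxE. Qed.

Lemma map_row_seq (K L : Type) (f : K -> L) k (l : 'rV[K]_k) :
  row_seq (map_mx f l) = map f (row_seq l).
Proof. by rewrite /row_seq -map_comp; apply: eq_map => a /=; rewrite mxE. Qed.

(** [det_diag_rank1] over polynomials, with diagonal entries [1 + l_i X], nonzero by their constant
    term. The rank-one part carries a factor [X], hence the drop from [j.+1] to [j] in the sum. *)
Lemma ecoef_diag_rank1 (K : idomainType) k (l r : 'rV[K]_k) (c : 'cV[K]_k) j :
  ecoef (diag_mx l + c *m r) j.+1 =
  elem_sym (row_seq l) j.+1 + \sum_i r 0 i * c i 0 * elem_sym (row_rem l i) j.
Proof.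
pose a : 'rV[{poly K}]_k := \row_i (1 + l 0 i *: 'X).
have aE : 1%:M + 'X *: map_mx polyC (diag_mx l + c *m r) =
   diag_mx a + ('X *: map_mx polyC c) *m map_mx polyC r.
  rewrite map_mxD map_mxM scalerDr addrA -scalemxAl; congr (_ + _).
  rewrite map_diag_mx -diag_const_mx -linearZ -linearD; congr diag_mx.
  by apply/matrixP => x y; rewrite !ord1 !mxE -!mul_polyC mulrC.
have a0 i : a 0 i != 0.
  apply/eqP => /(congr1 (fun p : {poly K} => p`_0)).
  by rewrite mxE coefD coefZ coefX mulr0 addr0 coef1 coef0; apply/eqP/oner_neq0.
rewrite /ecoef aE det_diag_rank1 // coefD; congr (_ + _).
  by rewrite /elem_sym big_map big_enum /=; congr (polyseq _)`__; apply: eq_big => // i _; rewrite mxE.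
rewrite coef_sum; apply: eq_bigr => i _.
rewrite !mxE (mulrCA _%:P) -polyCM -[in LHS]mulrA coefXM /= coefCM; congr (_ * _).
rewrite /elem_sym big_map big_filter big_enum_cond /=; congr (polyseq _)`__.
by apply: eq_bigr => x _; rewrite mxE.
Qed.

(** * Spectral decomposition and positive semidefinite perturbations *)

Section Hermitian.
Variable R : rcfType.
Local Notation C := R[i].
Local Notation toC := (real_complex R).
Local Open Scope sesquilinear_scope.

Lemma hermitian_diag k (A : 'M[C]_k) : A^t* = A ->
  exists (U : 'M[C]_k) (l : 'rV[R]_k),
    U *m U^t* = 1%:M /\ A = U^t* *m diag_mx (map_mx toC l) *m U.
Proof.
move=> hA; have Ah : A \is hermsymmx.
  by apply/is_hermitianmxP; rewrite expr0 scale1r hA.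
have := hermitian_spectral_diag_real Ah; have := spectral_unitarymx A.
have /orthomx_spectralP := hermitian_normalmx Ah.
move: (spectralmx A) (spectral_diag A) => U l AE Uu lR.
exists U, (map_mx (@complex.Re R) l); split; first exact/unitarymxP.
suff -> : map_mx toC (map_mx (@complex.Re R) l) = l.
  by rewrite -(invmx_unitary Uu).
apply/matrixP => i j; rewrite !mxE.
have := mxOverP lR i j; move: (l i j) => x /CrealP.
by case: x => x y [] /eqP; rewrite eqNr => /eqP ->.
Qed.

Lemma ecoef_unitary k (U M : 'M[C]_k) j : U *m U^t* = 1%:M ->
  ecoef (U^t* *m M *m U) j = ecoef M j.
Proof. by move=> /mulmx1C; apply: ecoef_conj. Qed.

(** In an eigenbasis of [A] the increments are [|w_i|^2] times quantities positive by
    [elem_sym_rem_gt0]. The weak bound is kept for every [j <= m] so that positivity survives and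
    further rank-one terms can be added. *)
Lemma ecoef_add_rank1 k (A : 'M[C]_k) (v : 'rV[C]_k) m : A^t* = A ->
  (forall j, (j <= m)%N -> 0 < ecoef A j) ->
  (forall j, (j <= m)%N -> ecoef A j <= ecoef (A + v^t* *m v) j) /\
  (v != 0 -> (0 < m)%N -> ecoef A m < ecoef (A + v^t* *m v) m).
Proof.
move=> /hermitian_diag [U [l [UU AE]]] pos.
pose w := v *m U^t*.
have AvE : A + v^t* *m v = U^t* *m (diag_mx (map_mx toC l) + w^t* *m w) *m U.
  rewrite mulmxDr mulmxDl -AE /w trmx_mul map_mxM trmxCK -!mulmxA; congr (_ + _).
  by rewrite !mulmxA (mulmx1C UU) mul1mx -mulmxA (mulmx1C UU) mulmx1.
have EA j : ecoef A j = toC (elem_sym (row_seq l) j).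
  by rewrite AE ecoef_unitary // ecoef_diag map_row_seq map_elem_sym.
have EB j : ecoef (A + v^t* *m v) j.+1 = ecoef A j.+1 +
    \sum_i `|w 0 i| ^+ 2 * toC (elem_sym (row_rem l i) j).
  rewrite AvE ecoef_unitary // ecoef_diag_rank1 EA map_row_seq map_elem_sym.
  congr (_ + _); apply: eq_bigr => i _.
  by rewrite map_row_rem map_elem_sym !mxE normCK.
have remP i j : (j < m)%N -> 0 < toC (elem_sym (row_rem l i) j).
  move=> jm; rewrite (_ : 0 = toC 0) ?rmorph0 // ltcR.
  apply: (elem_sym_rem_gt0 (x := l 0 i)) jm => h hm.
  rewrite -(perm_elem_sym _ (perm_row_rem l i)) -ltcR -EA rmorph0; exact: pos.
have sum_ge0 j i : (j < m)%N ->
    0 <= `|w 0 i| ^+ 2 * toC (elem_sym (row_rem l i) j).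
  by move=> jm; rewrite mulr_ge0 ?exprn_ge0 // ltW // remP.
split=> [[|j] jm|v0].
- by rewrite !ecoef0.
- by rewrite EB lerDl; apply: sumr_ge0 => i _; apply: sum_ge0.
case: m pos remP sum_ge0 => // m pos remP sum_ge0 _.
have : w != 0.
  apply: contraNneq v0 => w0.
  by rewrite -[v]mulmx1 -(mulmx1C UU) mulmxA -/w w0 mul0mx.
case/rV0Pn => i wi; rewrite EB ltrDl (bigD1 i) //= ltr_pwDl //.
  by rewrite mulr_gt0 ?remP // exprn_gt0 // normr_gt0.
by apply: sumr_ge0 => h _; apply: sum_ge0.
Qed.

Lemma hermitian_add_rank1 k (A : 'M[C]_k) (v : 'rV[C]_k) :
  A^t* = A -> (A + v^t* *m v)^t* = A + v^t* *m v.
Proof. by move=> hA; rewrite raddfD /= map_mxD hA trmx_mul map_mxM trmxCK. Qed.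

Lemma ecoef_add_sum_rank1 k (r : seq 'rV[C]_k) (A : 'M[C]_k) m : A^t* = A ->
  (forall j, (j <= m)%N -> 0 < ecoef A j) ->
  forall j, (j <= m)%N -> ecoef A j <= ecoef (A + \sum_(v <- r) v^t* *m v) j.
Proof.
elim: r A => [|v r IH] A hA pos j jm; first by rewrite big_nil addr0.
have [le _] := ecoef_add_rank1 v hA pos.
rewrite big_cons addrA; apply: (le_trans (le _ jm)).
apply: (IH _ (hermitian_add_rank1 v hA) _ _ jm) => h hm.
exact: lt_le_trans (pos _ hm) (le _ hm).
Qed.

(** For [v = a + I b] the mixed terms cancel by symmetry of [D], leaving the forms at [a] and
    [b]. *)
Lemma psd_complex k (D : 'M[R]_k) (v : 'rV[C]_k) : D^T = D ->
  (forall x : 'rV[R]_k, 0 <= (x *m D *m x^T) 0 0) ->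
  0 <= (v *m map_mx toC D *m v^t*) 0 0.
Proof.
move=> sD pD; pose a := map_mx (@complex.Re R) v; pose b := map_mx (@complex.Im R) v.
pose I : C := Complex 0 1.
have vE : v = map_mx toC a + I *: map_mx toC b.
  by apply/matrixP => i j; rewrite !mxE [LHS]complexE.
have vsE : v^t* = map_mx toC a^T - I *: map_mx toC b^T.
  apply/matrixP => i j; rewrite !mxE; case: (v j i) => x y.
  by apply/eqP; rewrite eq_complex /=; simpc; rewrite ?eqxx.
have cross : a *m D *m b^T = b *m D *m a^T.
  transitivity (a *m D *m b^T)^T; last by rewrite !trmx_mul trmxK sD mulmxA.
  by apply/matrixP => i j; rewrite !ord1 [RHS]mxE.
rewrite vE in vsE *; rewrite vsE => {vE vsE}.
rewrite !mulmxDl !mulmxBr -!scalemxAl -!scalemxAr -!map_mxM cross.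
rewrite addrA subrK scalerA -expr2 (_ : I ^+ 2 = -1); last exact: sqr_i.
rewrite scaleN1r opprK -map_mxD mxE (_ : 0 = toC 0) ?rmorph0 // lecR mxE.
by rewrite addr_ge0.
Qed.

(** By the spectral theorem [D] is a sum of rank-one terms built from the rows of [U] scaled by
    square roots of eigenvalues. A term with nonzero eigenvalue is added first and gives
    strictness. *)
Lemma ecoef_lt k (M D : 'M[R]_k) m : M^T = M -> D^T = D ->
  (forall x : 'rV[R]_k, 0 <= (x *m D *m x^T) 0 0) -> D != 0 -> (0 < m)%N ->
  (forall j, (j <= m)%N -> 0 < ecoef M j) ->
  ecoef M m < ecoef (M + D) m.
Proof.
move=> sM sD pD D0 m0 pos.
have realh (N : 'M[R]_k) : N^T = N -> (map_mx toC N)^t* = map_mx toC N.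
  move=> sN; rewrite -{2}sN; apply/matrixP => i j; rewrite !mxE; exact: conjc_real.
have [U [d [UU DE]]] := hermitian_diag (realh _ sD).
have d0 i : 0 <= d 0 i.
  have := psd_complex (row i U) sD pD.
  rewrite DE rowE trmx_mul map_mxM trmx_delta map_delta_mx !mulmxA.
  rewrite -(mulmxA _ U (U^t* )) UU mulmx1 -(mulmxA _ U (U^t* )) UU mulmx1 -rowE -colE.
  by rewrite !mxE eqxx mulr1n (_ : 0 = toC 0) ?rmorph0 // lecR.
pose v i := toC (Num.sqrt (d 0 i)) *: row i U.
have DvE : map_mx toC D = \sum_i (v i)^t* *m v i.
  rewrite DE; apply/matrixP => a b; rewrite mxE summxE; apply: eq_bigr => i _.
  rewrite mul_mx_diag !mxE big_ord1 !mxE rmorphM /=.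
  rewrite [X in _ = X * _ * _](conjc_real _ : (toC _)^* = _).
  by rewrite -{1}(sqr_sqrtr (d0 i)) rmorphXn /=; ring.
have [i0 di0] : exists i, d 0 i != 0.
  apply/rV0Pn; apply: contraNneq D0 => d00.
  move: DE; rewrite d00 map_mx0 (_ : diag_mx 0 = 0); last first.
    by apply/matrixP => x y; rewrite !mxE mul0rn.
  by rewrite mulmx0 mul0mx => /eqP; rewrite map_mx_eq0.
have vi0 : v i0 != 0.
  rewrite scaler_eq0 negb_or fmorph_eq0 sqrtr_eq0 -ltNge lt_def di0 d0 /=.
  apply/eqP => U0; have := congr1 (row i0) UU.
  rewrite row_mul U0 mul0mx => /rowP/(_ i0)/eqP.
  by rewrite !mxE eqxx eq_sym oner_eq0.
rewrite -ltcR -!map_ecoef map_mxD DvE (bigD1 i0) //= addrA.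
have pos' j : (j <= m)%N -> 0 < ecoef (map_mx toC M) j.
  by move=> jm; rewrite map_ecoef (_ : 0 = toC 0) ?rmorph0 // ltcR pos.
have [le lt] := ecoef_add_rank1 (v i0) (realh _ sM) pos'.
apply: (lt_le_trans (lt vi0 m0)).
rewrite -big_filter -(big_map v xpredT (fun w => w^t* *m w)).
apply: ecoef_add_sum_rank1 (leqnn m); first exact: hermitian_add_rank1 (realh _ sM).
by move=> j jm; apply: lt_le_trans (le _ jm); apply: pos'.
Qed.

(** Identities over [R[i]] descend to [R] by injectivity. The factor [a] lets one list [l] serve all
    multiples of [M]. *)
Lemma symmetric_char_poly k (M : 'M[R]_k) : M^T = M ->
  exists l : 'rV[R]_k,
    (forall a, char_poly (a *: M) = \prod_i ('X - (a * l 0 i)%:P)) /\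
    forall j, ecoef M j = elem_sym (row_seq l) j.
Proof.
move=> sM.
have hM : (map_mx toC M)^t* = map_mx toC M.
  by rewrite -{2}sM; apply/matrixP => i j; rewrite !mxE; exact: conjc_real.
have [U [l [UU ME]]] := hermitian_diag hM; exists l; split; last first.
  move=> j; apply: (@complexI R); rewrite -map_ecoef ME ecoef_unitary //.
  by rewrite ecoef_diag map_row_seq map_elem_sym.
move=> a; apply: (map_poly_inj toC); rewrite map_char_poly map_mxZ ME.
rewrite scalemxAl scalemxAr (char_poly_conj _ (mulmx1C UU)).
rewrite -linearZ char_poly_trig ?diag_mx_is_trig // rmorph_prod; apply: eq_bigr => i _.
by rewrite rmorphB /= map_polyX map_polyC !mxE eqxx mulr1n /= -(rmorphM toC).
Qed.

End Hermitian.

(** * The cone Gamma_m *)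

Lemma sigma_m_elem_sym (R : realType) n m (l : 'rV[R]_n) :
  sigma_m m l = elem_sym (row_seq l) m.
Proof.
rewrite /elem_sym big_map big_enum /=.
rewrite (eq_bigr (fun i => l 0 i *: 'X + 1)); last by move=> i _; rewrite addrC.
rewrite bigA_distr coef_sum /sigma_m big_mkcond /=; apply: eq_bigr => A _.
have -> : \prod_(i < n) (if i \in A then l 0 i *: 'X else 1) =
   (\prod_(i in A) l 0 i) *: 'X^(#|A|) :> {poly R}.
  rewrite -big_mkcond /= scaler_prod.
  by rewrite prodr_const.
by rewrite coefZ coefXn eq_sym; case: eqP => _; rewrite ?mulr1 ?mulr0.
Qed.

Section GammaCone.
Variables (R : realType) (n : nat).

Lemma elem_sym_continuous (s : seq 'I_n) j :
  continuous (fun l : 'rV[R]_n => elem_sym [seq l 0 i | i <- s] j).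
Proof.
elim: s j => [|i s IH] [|j] l /=.
- by under eq_fun do rewrite elem_sym0; apply: cst_continuous.
- by apply: cst_continuous.
- by under eq_fun do rewrite elem_sym0; apply: cst_continuous.
under eq_fun do rewrite elem_sym_consS.
apply: (cvgD (IH j.+1 l)); apply: cvgM (IH j l).
exact: (@coord_continuous R 1 n 0 i l).
Qed.

Lemma elem_sym_ge0 (s : seq R) j : all (> 0) s -> 0 <= elem_sym s j.
Proof.
elim: s j => [|x s IH] [|j] //=; rewrite ?elem_sym0 //.
  by rewrite /elem_sym big_nil coef1.
by case/andP=> x0 s0; rewrite elem_sym_consS addr_ge0 ?mulr_ge0 ?IH ?ltW.
Qed.

Lemma elem_sym_gt0 (s : seq R) j : all (> 0) s -> (j <= size s)%N -> 0 < elem_sym s j.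
Proof.
elim: s j => [|x s IH] [|j] //=; rewrite ?elem_sym0 //.
by case/andP=> x0 s0 js; rewrite elem_sym_consS ltr_wpDl ?elem_sym_ge0 ?mulr_gt0 ?IH.
Qed.

(* By Newton's inequalities the ratios [elem_sym j.+1 / elem_sym j] decrease. *)
Lemma elem_sym_ratio (s : seq R) m : (forall j, (j <= m)%N -> 0 < elem_sym s j) ->
  forall j, (j < m)%N -> elem_sym s j.+1 <= elem_sym s 1 * elem_sym s j.
Proof.
move=> pos; elim=> [|j IH] jm; first by rewrite elem_sym0 mulr1.
have := newton s j; have := IH (ltnW jm).
have := pos _ (ltnW jm); have := pos _ (ltnW (ltnW jm)).
move: (elem_sym s j) (elem_sym s j.+1) (elem_sym s j.+2) (elem_sym s 1) => a b c d a0 b0 bda acb.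
rewrite -(ler_pM2l a0); apply: (le_trans acb).
by rewrite expr2 (_ : a * (d * b) = b * (d * a)) ?ler_pM2l //; ring.
Qed.

(** Connectedness: within [Gamma_m], positivity of all [S_j], [j <= m], is an open condition met at
    the base point. It is also closed, being equivalent there to [S_j >= 0] and [S_(j+1) <= S_1 S_j]
    for [j < m]. *)
Lemma Gamma_elem_sym_gt0 m (l : 'rV[R]_n) : (m <= n)%N -> Gamma_m m l ->
  forall j, (j <= m)%N -> 0 < elem_sym (row_seq l) j.
Proof.
move=> mn Gl.
pose S j (l : 'rV[R]_n) := elem_sym (row_seq l) j.
have cS j : continuous (S j) by apply: elem_sym_continuous.
pose P := [set l | forall j : 'I_m.+1, 0 < S j l].
suff PG : Gamma_m m `&` P = Gamma_m m.
  move=> j jm; move: Gl; rewrite -PG => -[_ /(_ (Ordinal (jm : (j < m.+1)%N)))].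
  exact.
have G0 (x : 'rV[R]_n) : Gamma_m m x -> 0 < S m x.
  move=> /connected_component_sub /=; rewrite /Hm sigma_m_elem_sym pmulr_lgt0 //.
  by rewrite invr_gt0 ltr0n bin_gt0.
have P1 : P (const_mx 1).
  move=> j; apply: elem_sym_gt0.
    by apply/allP => _ /mapP[i _ ->]; rewrite mxE ltr01.
  by rewrite size_map size_enum_ord (leq_trans _ mn) // -ltnS.
have PA : 0 < Hm m (const_mx 1 : 'rV[R]_n).
  rewrite /Hm sigma_m_elem_sym divr_gt0 ?ltr0n ?bin_gt0 //.
  exact: (P1 ord_max).
have /(_ (Gamma_m m `&` P)) := @component_connected _ [set l : 'rV[R]_n | 0 < Hm m l] (const_mx 1).
apply.
- by exists (const_mx 1); split => //; apply: connected_component_refl.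
- exists P => //; rewrite openE => x Px.
  apply: (@filter_forall _ 'I_m.+1 (fun j y => 0 < S j y) (nbhs x)) => j.
  by apply: (cvgr_gt (S j x) (cS j x)); exact: Px.
exists (\bigcap_(j in [set j | (j < m)%N])
  ([set l | 0 <= S j l] `&` [set l | 0 <= S 1%N l * S j l - S j.+1 l])).
  have clos (f : 'rV[R]_n -> R) : continuous f -> closed [set l | 0 <= f l].
    by move=> /continuous_closedP cf; exact: (cf _ (@closed_ge R 0)).
  apply: closed_bigI => j _; apply: closedI; apply: clos; first exact: cS.
  by move=> x; exact: cvgB (cvgM (cS 1 x) (cS j x)) (cS j.+1 x).
apply/seteqP; split => x [Gx Px]; split => //.
  have pos j : (j <= m)%N -> 0 < S j x.
    by move=> jm; exact: (Px (Ordinal (jm : (j < m.+1)%N))).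
  move=> j /= jm; split; first by rewrite ltW // pos // ltnW.
  by rewrite subr_ge0; apply: elem_sym_ratio jm.
(* Downward induction from [S_m > 0]: if [S_i] vanished, the ratio bound would make [S_(i+1)]
   nonpositive. *)
suff pos d : (d <= m)%N -> 0 < S (m - d)%N x.
  by move=> j; rewrite -[nat_of_ord j](subKn (leq_ord j)) pos // leq_subr.
elim: d => [|d IH] dm; first by rewrite subn0 G0.
have := IH (ltnW dm); rewrite -(subnSK dm); set i := (m - d.+1)%N => Si.
have im : (i < m)%N by rewrite /i; lia.
have [/= Si0 Sr] := Px i im.
rewrite lt_def Si0 andbT; apply/eqP => S0.
by move: Sr; rewrite S0 mulr0 sub0r oppr_ge0 leNgt Si.
Qed.

End GammaCone.

(** * Curvature matrices *)

Section LinAlg.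
Variable R : realType.

Lemma edotE k (x y : 'rV[R]_k) : x *m y^T = (edot x y)%:M.
Proof.
apply/matrixP => i j; rewrite !ord1 !mxE eqxx mulr1n.
by apply: eq_bigr => h _; rewrite mxE.
Qed.

Lemma edot_ge0 k (x : 'rV[R]_k) : 0 <= edot x x.
Proof. by apply: sumr_ge0 => i _; rewrite -expr2 sqr_ge0. Qed.

Lemma edot_eq0 k (x : 'rV[R]_k) : edot x x = 0 -> x = 0.
Proof.
move=> /eqP; rewrite psumr_eq0 => [/allP x0|i _]; last by rewrite -expr2 sqr_ge0.
apply/rowP => i; have := x0 i (mem_index_enum _).
by rewrite /= -expr2 sqrf_eq0 mxE => /eqP.
Qed.

Variable n : nat.
Implicit Types (u p x : 'rV[R]_n.+1) (Y : 'M[R]_n.+1).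

Definition slope p : R := Num.sqrt (1 + edot p p).

(* With [p = Dz / sinh z] and [Y = D^2z / sinh z], the second fundamental form
   is [sinh z / slope p] times this matrix. *)
Definition curv_mx u p c Y : 'M[R]_n.+1 :=
  - (tproj u *m Y *m tproj u) + (2 * c) *: (p^T *m p) + c *: tproj u.

(* The inverse square root of [1 + p^T p]. *)
Definition isqrt_mx p : 'M[R]_n.+1 :=
  1%:M - (slope p * (slope p + 1))^-1 *: (p^T *m p).

Lemma slope_gt0 p : 0 < slope p.
Proof. by rewrite sqrtr_gt0 ltr_pwDl // edot_ge0. Qed.

Lemma slope_sqr p : slope p ^+ 2 = 1 + edot p p.
Proof. by rewrite sqr_sqrtr // addr_ge0 // edot_ge0. Qed.

Lemma isqrt_sym p : (isqrt_mx p)^T = isqrt_mx p.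
Proof. by rewrite /isqrt_mx raddfB /= trmx1 linearZ /= trmx_mul trmxK. Qed.

(** [T = p^T p] satisfies [T^2 = |p|^2 T], so products keep the form [1 + x T]; the last coefficient
    vanishes because [|p|^2 = slope p ^ 2 - 1]. *)
Lemma isqrt_mxE p : isqrt_mx p *m (1%:M + p^T *m p) *m isqrt_mx p = 1%:M.
Proof.
have TT : p^T *m p *m (p^T *m p) = edot p p *: (p^T *m p).
  by rewrite mulmxA -(mulmxA p^T) edotE mul_mx_scalar -scalemxAl.
have W0 := slope_gt0 p; have W2 := slope_sqr p.
rewrite /isqrt_mx; set T := p^T *m p in TT *; set b := _^-1.
have step (x y : R) : (1%:M + x *: T) *m (1%:M + y *: T) =
    1%:M + (x + y + x * y * edot p p) *: T.
  rewrite mulmxDr mulmx1 mulmxDl mul1mx -scalemxAl -!scalemxAr TT !scalerA.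
  by rewrite -addrA -!scalerDl; congr (_ + _ *: _); ring.
have -> : 1%:M + T = 1%:M + 1 *: T by rewrite scale1r.
rewrite -scaleNr !step [X in X *: T](_ : _ = 0) ?scale0r ?addr0 //.
have -> : edot p p = slope p ^+ 2 - 1 by rewrite W2 addrC addKr.
by rewrite /b; field; rewrite !gt_eqF // addr_gt0.
Qed.

(** [P] and [E] are the tangential and normal projections. Conjugation by [s^-1 P + E] removes
    [s ^ 2] from the first fundamental form and leaves the normal block alone. *)
Lemma proj_rescale (P E T N : 'M[R]_n.+1) s : s != 0 -> P + E = 1%:M ->
  P *m P = P -> E *m E = E -> P *m T = T -> T *m P = T ->
  P *m N = N -> N *m P = N ->
  (s^-1 *: P + E) *m (s ^+ 2 *: P + s ^+ 2 *: T + E) *m (s^-1 *: P + E) = 1%:M + T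
  /\ (s^-1 *: P + E) *m N *m (s^-1 *: P + E) = s ^- 2 *: N.
Proof.
move=> s0 PE1 PP EE PT TP PN NP.
have EE1 : E = 1%:M - P by rewrite -PE1 addrC addKr.
have E0 (A : 'M[R]_n.+1) : P *m A = A -> E *m A = 0.
  by move=> PA; rewrite EE1 mulmxBl mul1mx PA subrr.
have E0' (A : 'M[R]_n.+1) : A *m P = A -> A *m E = 0.
  by move=> PA; rewrite EE1 mulmxBr mulmx1 PA subrr.
have PE : P *m E = 0 by apply: E0'.
have EP : E *m P = 0 by apply: E0.
have ET : E *m T = 0 by apply: E0.
have TE : T *m E = 0 by apply: E0'.
have EN : E *m N = 0 by apply: E0.
have NE : N *m E = 0 by apply: E0'.
clear EE1 E0 E0'; split; last first.
  rewrite mulmxDl -scalemxAl PN EN addr0 mulmxDr -!scalemxAl NE scaler0 addr0.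
  by rewrite -scalemxAr NP scalerA -expr2 exprVn.
have -> : (s^-1 *: P + E) *m (s ^+ 2 *: P + s ^+ 2 *: T + E) = s *: (P + T) + E.
  rewrite mulmxDl 4!mulmxDr -!scalemxAl -!scalemxAr.
  rewrite !(PP, PT, PE, EP, ET, EE, scaler0, addr0, add0r) -!scalerDr scalerA.
  by rewrite expr2 mulrA mulVf // mul1r.
rewrite mulmxDl !mulmxDr -!scalemxAl -!scalemxAr !mulmxDl.
rewrite !(PP, TP, PE, TE, EP, EE, scaler0, addr0, add0r) scalerA divff // scale1r.
by rewrite addrAC PE1.
Qed.

Section Data.
Variables (u p : 'rV[R]_n.+1).
Hypotheses (uu : edot u u = 1) (up : edot u p = 0).

Let P := tproj u.
Let E := u^T *m u.
Let T := p^T *m p.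

Lemma edotC k (x y : 'rV[R]_k) : edot x y = edot y x.
Proof. by apply: eq_bigr => i _; rewrite mulrC. Qed.

Lemma uP : u *m P = 0.
Proof. by rewrite /P /tproj mulmxBr mulmx1 mulmxA edotE uu mul1mx subrr. Qed.

Lemma pP : p *m P = p.
Proof.
by rewrite /P /tproj mulmxBr mulmx1 mulmxA edotE edotC up mul_scalar_mx scale0r subr0.
Qed.

Lemma trP : P^T = P.
Proof. by rewrite /P /tproj raddfB /= trmx1 trmx_mul trmxK. Qed.

Lemma PpT : P *m p^T = p^T.
Proof. by rewrite -{1}trP -trmx_mul pP. Qed.

Lemma PP : P *m P = P.
Proof. by rewrite {1}/P /tproj mulmxBl mul1mx -mulmxA uP mulmx0 subr0. Qed.

Lemma uS : u *m isqrt_mx p = u.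
Proof.
by rewrite /isqrt_mx mulmxBr mulmx1 -scalemxAr mulmxA edotE up mul_scalar_mx scale0r scaler0 subr0.
Qed.

Lemma curv_mxP c Y : curv_mx u p c Y *m P = curv_mx u p c Y.
Proof.
rewrite /curv_mx -/P 2!mulmxDl mulNmx -!scalemxAl PP -(mulmxA _ P P) PP.
by rewrite -(mulmxA _ p P) pP.
Qed.

Lemma Pcurv_mx c Y : P *m curv_mx u p c Y = curv_mx u p c Y.
Proof.
rewrite /curv_mx -/P 2!mulmxDr mulmxN -!scalemxAr PP !mulmxA PP.
by rewrite PpT.
Qed.

Lemma curv_sym c Y : Y^T = Y -> (curv_mx u p c Y)^T = curv_mx u p c Y.
Proof.
move=> sY; rewrite /curv_mx -/P.
have trD (A B : 'M[R]_n.+1) : (A + B)^T = A^T + B^T by rewrite raddfD.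
have trZ a (A : 'M[R]_n.+1) : (a *: A)^T = a *: A^T by rewrite linearZ.
by rewrite 2!trD raddfN /= 2!trZ !trmx_mul trmxK trP sY mulmxA.
Qed.

Lemma root_char_poly0 (M : 'M[R]_n.+1) : u *m M = 0 -> (char_poly M).[0] = 0.
Proof.
move=> uM; apply/eqP; rewrite -/(root _ _) -eigenvalue_root_char.
apply/eigenvalueP; exists u; first by rewrite uM scale0r.
apply/eqP => u0; have := uu; rewrite u0 /edot big1; last by move=> i _; rewrite mxE mul0r.
by move/eqP; rewrite eq_sym oner_eq0.
Qed.

(** With [Q G Q^T = 1], the determinant of [X G - H] is [\det G] times the characteristic polynomial
    of the symmetric matrix [Q H Q^T]. This yields real principal curvatures and their symmetric
    functions. *)
Lemma curvature_eigenvalues s c Y : 0 < s -> Y^T = Y ->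
  let G := (s ^+ 2 *: P + s ^+ 2 *: T) + E in
  let H := (s / slope p) *: curv_mx u p c Y in
  exists l : 'rV[R]_n,
    \det G *: ('X * \prod_(i < n) ('X - (l 0 i)%:P)) =
      \det (\matrix_(i < n.+1, j < n.+1) (G i j *: 'X - (H i j)%:P)) /\
    forall j, ecoef (isqrt_mx p *m curv_mx u p c Y *m isqrt_mx p) j =
      (s * slope p) ^+ j * sigma_m j l.
Proof.
move=> s0 sY G H.
have W0 := slope_gt0 p.
set S := isqrt_mx p; set N := curv_mx u p c Y.
have sM : (S *m N *m S)^T = S *m N *m S.
  by rewrite !trmx_mul isqrt_sym curv_sym // mulmxA.
have [l [charM ecoefM]] := symmetric_char_poly sM.
(* The factor [s / slope p] of [H] times the factor [s ^- 2] from the rescaling. *)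
pose a := (s * slope p)^-1.
have sW0 : s * slope p != 0 by rewrite gt_eqF // mulr_gt0.
have a0 : a != 0 by rewrite invr_eq0.
(* The normal direction [u] contributes an eigenvalue 0; [lam] omits it, which does not affect the
   elementary symmetric functions. *)
have [i0 li0] : exists i, l 0 i = 0.
  have : (char_poly (1 *: (S *m N *m S))).[0] = 0.
    apply: root_char_poly0; rewrite scale1r !mulmxA uS -[N]Pcurv_mx.
    by rewrite mulmxA uP !mul0mx.
  rewrite charM horner_prod => /eqP; rewrite prodf_seq_eq0 => /hasP[i _].
  by rewrite hornerXsubC sub0r oppr_eq0 mul1r => /eqP; exists i.
pose lam : 'rV[R]_n := \row_i (a * l 0 (lift i0 i)).
exists lam; split; last first.
  move=> j; rewrite ecoefM sigma_m_elem_sym -elem_sym_scale.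
  rewrite /elem_sym [in LHS]big_map [in RHS]big_map [in RHS]big_map !big_enum /=.
  rewrite (bigD1_ord i0) //= li0 scale0r addr0 mul1r.
  congr (polyseq _)`__; apply: eq_bigr => i _.
  by rewrite mxE mulrA divff // mul1r.
pose Dd := s^-1 *: P + E.
pose Q := S *m Dd.
have EE : E *m E = E by rewrite /E mulmxA -(mulmxA u^T) edotE uu mulmx1.
have PT : P *m T = T by rewrite /T mulmxA PpT.
have TP : T *m P = T by rewrite /T -mulmxA pP.
have PE1 : P + E = 1%:M by rewrite /P /tproj subrK.
have trDd : Dd^T = Dd by rewrite raddfD /= linearZ /= trP trmx_mul trmxK.
have [DGD DND] := proj_rescale (lt0r_neq0 s0) PE1 PP EE PT TP (Pcurv_mx c Y) (curv_mxP c Y).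
have {DND}DHD : Dd *m H *m Dd = a *: N.
  rewrite /H -scalemxAr -scalemxAl DND scalerA.
  by congr (_ *: _); rewrite /a; field; rewrite !gt_eqF.
have QGQ : Q *m G *m Q^T = 1%:M.
  rewrite /Q trmx_mul trDd isqrt_sym !mulmxA -(mulmxA S) -(mulmxA S) DGD.
  exact: isqrt_mxE.
have QHQ : Q *m H *m Q^T = a *: (S *m N *m S).
  rewrite /Q trmx_mul trDd isqrt_sym !mulmxA -(mulmxA S) -(mulmxA S) DHD.
  by rewrite -scalemxAr -scalemxAl.
clear DGD DHD; clearbody G H Q.
have dQ : \det Q ^+ 2 * \det G = 1.
  have := congr1 determinant QGQ.
  by rewrite det_mulmx det_mulmx det_tr det1 => <-; ring.
have charE : (\det Q ^+ 2)%:P * \det (\matrix_(i, j) (G i j *: 'X - (H i j)%:P)) =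
    'X * \prod_(i < n) ('X - (lam 0 i)%:P).
  have -> : 'X * \prod_(i < n) ('X - (lam 0 i)%:P) = char_poly (a *: (S *m N *m S)).
    rewrite charM (bigD1_ord i0) //= li0 mulr0 subr0; congr (_ * _).
    by apply: eq_bigr => i _; rewrite mxE.
  rewrite -QHQ /char_poly /char_poly_mx.
  have -> : 'X%:M - map_mx polyC (Q *m H *m Q^T) = map_mx polyC Q *m
     (\matrix_(i, j) (G i j *: 'X - (H i j)%:P)) *m map_mx polyC Q^T.
    have -> : \matrix_(i, j) (G i j *: 'X - (H i j)%:P) =
       'X *: map_mx polyC G - map_mx polyC H.
      by apply/matrixP => i j; rewrite !mxE -mul_polyC mulrC.
    rewrite mulmxBr mulmxBl -scalemxAr -scalemxAl -!map_mxM QGQ map_mx1.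
    by rewrite scalemx1.
  rewrite det_mulmx det_mulmx -map_trmx det_tr det_map_mx polyC_exp expr2 /=.
  by ring.
by rewrite -charE -mul_polyC mulrA -polyCM [_ * _ ^+ 2]mulrC dQ mul1r.
Qed.

Lemma tproj_neq0 : (0 < n)%N -> P != 0.
Proof.
move=> n0; apply/eqP => P0.
have : \tr P = n%:R.
  rewrite /P /tproj raddfB /= mxtrace1 mxtrace_mulC edotE uu mxtrace1.
  by rewrite -[1%:R]/(1) -natr1 addrK.
rewrite P0 raddf0 => /esym/eqP; rewrite pnatr_eq0 => /eqP n00.
by rewrite n00 in n0.
Qed.

Lemma curv_mx_quad c Y x :
  (x *m curv_mx u p c Y *m x^T) 0 0 =
  - ((x *m P) *m Y *m (x *m P)^T) 0 0 +
  2 * c * edot x p ^+ 2 + c * edot (x *m P) (x *m P).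
Proof.
have tr_entry (A B : 'M[R]_1) : (A + B) 0 0 = A 0 0 + B 0 0 by rewrite mxE.
rewrite /curv_mx -/P 2!mulmxDr 2!mulmxDl 2!tr_entry mulmxN mulNmx mxE.
rewrite -!scalemxAr -!scalemxAl [X in _ + X + _]mxE [X in _ + _ + X]mxE.
congr (- _ + _ + _).
- by rewrite trmx_mul trP !mulmxA.
- congr (_ * _); rewrite mulmxA -(mulmxA (x *m p^T)) !edotE -scalar_mxM mxE eqxx mulr1n.
  by rewrite (edotC p x) expr2.
- congr (_ * _); rewrite -[in LHS]PP mulmxA -(mulmxA (x *m P)) -{2}trP -trmx_mul edotE.
  by rewrite mxE eqxx mulr1n.
Qed.

End Data.

(** For [v = ln (tanh (z / 2))], [p] is the gradient and [Y - c p^T p] the Hessian. Passing from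
    [Y - c p^T p] to [Y] costs at most [(c1 - c2) (x . p)^2], which the term [2 c p^T p] of
    [curv_mx] covers twice over, so the curvature matrices differ by at least [(c1 - c2) P]. *)
Lemma curv_ecoef_lt u p c1 c2 Y1 Y2 m : edot u u = 1 -> edot u p = 0 ->
  (0 < n)%N -> (0 < m)%N -> Y1^T = Y1 -> Y2^T = Y2 -> c2 < c1 ->
  (forall x, (x *m (Y1 - c1 *: (p^T *m p)) *m x^T) 0 0 <=
             (x *m (Y2 - c2 *: (p^T *m p)) *m x^T) 0 0) ->
  (forall j, (j <= m)%N ->
     0 < ecoef (isqrt_mx p *m curv_mx u p c2 Y2 *m isqrt_mx p) j) ->
  ecoef (isqrt_mx p *m curv_mx u p c2 Y2 *m isqrt_mx p) m <
  ecoef (isqrt_mx p *m curv_mx u p c1 Y1 *m isqrt_mx p) m.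
Proof.
move=> uu up n0 m0 sY1 sY2 c21 Yle pos.
set S := isqrt_mx p in pos *; set N1 := curv_mx u p c1 Y1.
set N2 := curv_mx u p c2 Y2 in pos *.
have -> : S *m N1 *m S = S *m N2 *m S + S *m (N1 - N2) *m S.
  have split (A B C : 'M[R]_n.+1) : A *m B *m A = A *m C *m A + A *m (B - C) *m A.
    by rewrite mulmxBr mulmxBl addrC subrK.
  exact: split.
have quadB x (A B : 'M[R]_n.+1) :
    (x *m (A - B) *m x^T) 0 0 = (x *m A *m x^T) 0 0 - (x *m B *m x^T) 0 0.
  by rewrite mulmxBr mulmxBl mxE [X in _ + X]mxE.
have sN1 : N1^T = N1 by apply: curv_sym.
have sN2 : N2^T = N2 by apply: curv_sym.
have sN : (N1 - N2)^T = N1 - N2 by rewrite [LHS]raddfB /= sN1 sN2.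
have quad x : (c1 - c2) * edot (x *m tproj u) (x *m tproj u) <=
    (x *m (N1 - N2) *m x^T) 0 0.
  rewrite quadB !curv_mx_quad //.
  have := Yle (x *m tproj u).
  rewrite 2!quadB -!scalemxAr -!scalemxAl.
  have -> : x *m tproj u *m (p^T *m p) *m (x *m tproj u)^T = (edot x p ^+ 2)%:M.
    rewrite trmx_mul trP !mulmxA -(mulmxA x) PpT // -(mulmxA _ p) pP //.
    by rewrite -(mulmxA (x *m p^T)) !edotE -scalar_mxM (edotC p x) expr2.
  set A := (_ *m Y1 *m _); set B := (_ *m Y2 *m _).
  rewrite !mxE eqxx !mulr1n => le.
  have e0 : 0 <= (c1 - c2) * edot x p ^+ 2.
    by rewrite mulr_ge0 ?sqr_ge0 // subr_ge0 ltW.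
  lra.
apply: ecoef_lt => //.
- by rewrite !trmx_mul isqrt_sym sN2 mulmxA.
- by rewrite !trmx_mul isqrt_sym sN mulmxA.
- move=> x; have := quad (x *m S); rewrite trmx_mul isqrt_sym !mulmxA.
  by apply: le_trans; rewrite mulr_ge0 ?edot_ge0 // subr_ge0 ltW.
have Su : S \in unitmx.
  have : S *m ((1%:M + p^T *m p) *m S) = 1%:M by rewrite mulmxA isqrt_mxE.
  by case/mulmx1_unit.
(* As [S] is invertible, a zero difference forces [N1 = N2], and then every row of the projection
   has norm zero. *)
apply/eqP => D0; case/eqP: (tproj_neq0 uu n0); apply/row_matrixP => i.
rewrite row0 rowE; apply: edot_eq0; apply/eqP; rewrite eq_le edot_ge0 andbT.
have := quad (delta_mx 0 i); rewrite (_ : N1 - N2 = 0).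
  rewrite mulmx0 mul0mx mxE pmulr_rle0 // subr_gt0 //.
have : invmx S *m (S *m (N1 - N2) *m S) *m invmx S = N1 - N2.
  by rewrite !mulmxA mulVmx // mul1mx mulmxK.
by rewrite D0 mulmx0 mul0mx.
Qed.

End LinAlg.

(** * Second-order calculus in several variables *)

Section LineCalculus.
Variable R : realType.

Lemma is_derive_line k (F : 'rV[R]_k -> R) (y v : 'rV[R]_k) (t L : R) :
  is_derive (y + t *: v) v F L -> is_derive t 1 (fun s => F (y + s *: v)) L.
Proof.
have E : (fun h : R => h^-1 *: (((fun s => F (y + s *: v)) \o shift t) (h *: 1) -
     (fun s => F (y + s *: v)) t)) =
   (fun h : R => h^-1 *: ((F \o shift (y + t *: v)) (h *: v) - F (y + t *: v))).
  apply/funext => h /=; congr (_ *: (F _ - _)).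
  by rewrite [h *: 1]mulr1 scalerDl addrCA.
move=> [d1 d2]; split; first by rewrite /derivable E.
by rewrite /derive E.
Qed.

Lemma mean_value (f df : R -> R) (h : R) :
  (forall t : R, `|t| <= `|h| -> is_derive t 1 f (df t)) ->
  exists2 c, `|c| <= `|h| & f h - f 0 = h * df c.
Proof.
move=> fd.
have cont a b : (forall t, t \in `[a, b] -> `|t| <= `|h|) ->
    {within `[a, b], continuous f}.
  move=> ab; apply: derivable_within_continuous => t /ab/fd [] //.
have [h0|h0] := leP 0 h.
- have habs (s : R) : s \in `[0, h] -> `|s| <= `|h|.
    by rewrite in_itv /= => /andP[t0 th]; rewrite !ger0_norm.
  have [t tI||c cI ->] := @MVT_segment R f df 0 h h0.
  - by apply: fd; apply: habs; apply: subset_itv_oo_cc tI.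
  - exact: cont.
  by exists c; [exact: habs|rewrite subr0 mulrC].
- have habs (s : R) : s \in `[h, 0] -> `|s| <= `|h|.
    rewrite in_itv /= => /andP[t0 th].
    by rewrite (ltr0_norm h0) ler0_norm // lerN2.
  have [t tI||c cI E] := @MVT_segment R f df h 0 (ltW h0).
  - by apply: fd; apply: habs; apply: subset_itv_oo_cc tI.
  - exact: cont.
  by exists c; [exact: habs|rewrite -opprB E; ring].
Qed.

(** Strict directional derivative: the estimate is uniform in the base point [y] near [a]. This
    makes it additive in the direction, since the base point may move along [v] before the increment
    along [w]. *)
Definition strict_deriv k (F : 'rV[R]_k -> R) (a v : 'rV[R]_k) (L : R) : Prop :=
  forall e, 0 < e -> exists2 d, 0 < d & forall y h, `|y - a| < d -> `|h| < d ->
    `|F (y + h *: v) - F y - h * L| <= e * `|h|.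

Section Strict.
Variables (k : nat) (F : 'rV[R]_k -> R) (a : 'rV[R]_k).

Lemma strict_deriv0 : strict_deriv F a 0 0.
Proof.
move=> e e0; exists 1 => // y h _ _.
by rewrite scaler0 addr0 subrr mulr0 subrr normr0 mulr_ge0 // ltW.
Qed.

Lemma strict_derivD v w L M :
  strict_deriv F a v L -> strict_deriv F a w M -> strict_deriv F a (v + w) (L + M).
Proof.
move=> sv sw e e0; have e20 : 0 < e / 2 by rewrite divr_gt0.
have [d d0 dv] := sv _ e20; have [d' d'0 dw] := sw _ e20.
have v0 : 0 < `|v| + 1 by rewrite ltr_pwDr.
(* The last two bounds make [y - a] and [h *: v] shorter than [d' / 2], so [dw] applies at
   [y + h *: v]. *)
exists (Num.min d (Num.min (d' / 2) (d' / 2 / (`|v| + 1)))).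
  by rewrite !lt_min d0 !divr_gt0.
move=> y h; rewrite !lt_min => /and3P[yd yd' _] /and3P[hd hd' hv].
have hv' : `|h *: v| < d' / 2.
  rewrite normrZ; apply: le_lt_trans (_ : `|h| * (`|v| + 1) < _).
    by rewrite ler_wpM2l // lerDl.
  by rewrite -ltr_pdivlMr.
have yhv : `|y + h *: v - a| < d'.
  by rewrite addrAC (splitr d') (le_lt_trans (ler_normD _ _)) // ltrD.
have hd2 : `|h| < d' by apply: lt_trans hd' _; lra.
have := dw _ _ yhv hd2; have := dv _ _ yd hd.
rewrite scalerDr addrA; set A := F (_ + _ + _); set B := F (y + _).
move=> l1 l2; rewrite (_ : e * `|h| = e / 2 * `|h| + e / 2 * `|h|); last by field.
rewrite (_ : A - F y - h * (L + M) = (B - F y - h * L) + (A - B - h * M)); last by ring.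
by rewrite (le_trans (ler_normD _ _)) // lerD.
Qed.

Lemma strict_derivZ c v L : strict_deriv F a v L -> strict_deriv F a (c *: v) (c * L).
Proof.
move=> sv e e0; have c0 : 0 < `|c| + 1 by rewrite ltr_pwDr.
have [d d0 dv] := sv _ (divr_gt0 e0 c0).
have c1 : 1 <= `|c| + 1 by rewrite lerDr.
exists (d / (`|c| + 1)); first by rewrite divr_gt0.
move=> y h yd hd.
have yd' : `|y - a| < d.
  by apply: lt_le_trans yd _; rewrite ler_pdivrMr // ler_peMr // ltW.
have hcd : `|h * c| < d.
  rewrite normrM; apply: le_lt_trans (_ : `|h| * (`|c| + 1) < _).
    by rewrite ler_wpM2l // lerDl.
  by rewrite -ltr_pdivlMr.
have := dv _ _ yd' hcd; rewrite -scalerA scalerA mulrA => /le_trans; apply.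
rewrite normrM (_ : _ * _ = (e * `|h|) * (`|c| / (`|c| + 1))); last by ring.
by rewrite ler_piMr ?mulr_ge0 ?(ltW e0) // ler_pdivrMr // mul1r lerDl.
Qed.

Lemma strict_deriv_is_derive v L : strict_deriv F a v L -> is_derive a v F L.
Proof.
move=> sv.
have cv : h^-1 *: ((F \o shift a) (h *: v) - F a) @[h --> 0^'] --> L.
  apply/cvgrPdist_le => e e0; have [d d0 dv] := sv _ e0.
  near=> h.
  have h0 : h != 0 by near: h; exact: nbhs_dnbhs_neq.
  have hd : `|h| < d by near: h; apply: dnbhs0_lt.
  have := dv a h; rewrite subrr normr0 => /(_ d0 hd) le.
  rewrite -(ler_pM2r (_ : 0 < `|h|)) ?normr_gt0 // -normrM.
  rewrite [X in `|X|](_ : _ = - (F (a + h *: v) - F a - h * L)) ?normrN //.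
  by rewrite /= [h *: v + a]addrC /GRing.scale /=; field.
by split; [apply/cvg_ex; exists L|apply/cvg_lim].
Unshelve. all: by end_near. Qed.

(** The increment is [h * df] at a point of the segment; continuity of [df] at [a] bounds the error
    uniformly in [y]. *)
Lemma strict_deriv_partial v (df : 'rV[R]_k -> R) :
  (\forall y \near a, is_derive y v F (df y)) -> {for a, continuous df} ->
  strict_deriv F a v (df a).
Proof.
move=> dF cdf e e0.
have /nbhs_ballP[d /= d0 dP] : \forall y \near a,
    is_derive y v F (df y) /\ `|df a - df y| <= e.
  have cd : \forall y \near a, `|df a - df y| <= e.
    by move/cvgrPdist_le: cdf => /(_ _ e0).
  by apply: filterS2 dF cd.
have v0 : 0 < `|v| + 1 by rewrite ltr_pwDr.
exists (Num.min (d / 2) (d / 2 / (`|v| + 1))); first by rewrite lt_min !divr_gt0.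
move=> y h; rewrite !lt_min => /andP[yd _] /andP[_ hd].
have near_a t : `|t| <= `|h| -> ball a d (y + t *: v).
  move=> th; rewrite -ball_normE /= distrC addrAC (splitr d).
  rewrite (le_lt_trans (ler_normD _ _)) // ltrD // normrZ.
  apply: le_lt_trans (_ : `|h| * (`|v| + 1) < _); first by rewrite ler_pM // lerDl.
  by rewrite -ltr_pdivlMr.
have [t th|c ch] := @mean_value (fun t => F (y + t *: v)) (fun t => df (y + t *: v)) h.
  by apply: is_derive_line; case: (dP _ (near_a _ th)).
rewrite scale0r addr0 => ->; rewrite -mulrBr normrM mulrC ler_wpM2r //.
by rewrite distrC; case: (dP _ (near_a _ ch)).
Qed.

End Strict.

End LineCalculus.

(** * Symmetry of second derivatives and the second-derivative test *)

Section SecondOrder.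
Variable R : realType.

(** The mean value theorem along [v], applied to the difference of [F] on two parallel segments,
    leaves an increment of [dv] along [w] from the moving point [a + c *: v], which strictness
    controls. *)
Lemma second_difference k (F dv : 'rV[R]_k -> R) (a v w : 'rV[R]_k) (L : R) :
  (\forall y \near a, is_derive y v F (dv y)) -> strict_deriv dv a w L ->
  forall e, 0 < e -> \forall h \near (0 : R),
    `|F (a + h *: w + h *: v) - F (a + h *: w) - F (a + h *: v) + F a - h * (h * L)|
      <= e * (h * h).
Proof.
move=> dF sdv e e0.
have [d1 d10 d1P] := sdv e e0.
have /nbhs_ballP[d2 /= d20 d2P] := dF.
have v0 : 0 < `|v| + `|w| + 1 by rewrite ltr_pwDr // addr_ge0.
have small : \forall h \near (0 : R), `|h| * (`|v| + `|w| + 1) < Num.min d1 d2.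
  have m0 : 0 < Num.min d1 d2 / (`|v| + `|w| + 1) by rewrite divr_gt0 // lt_min d10.
  by apply: filterS (nbhs0_lt m0) => h; rewrite ltr_pdivlMr.
near=> h.
have hs : `|h| * (`|v| + `|w| + 1) < Num.min d1 d2 by near: h.
have hv c : `|c| <= `|h| -> `|c *: v| + `|h *: w| < Num.min d1 d2.
  move=> ch; rewrite !normrZ; apply: le_lt_trans hs.
  rewrite mulrDr mulr1 mulrDr -addrA lerD ?ler_wpM2r // lerDl //.
have [t th|c ch E] := @mean_value R (fun s => F (a + h *: w + s *: v) - F (a + s *: v))
    (fun s => dv (a + h *: w + s *: v) - dv (a + s *: v)) h.
  have := hv _ th; rewrite lt_min => /andP[_ td2].
  have := ler_normD (t *: v) (h *: w) => tri.
  apply: is_deriveB; apply: is_derive_line; apply: d2P; rewrite -ball_normE /= distrC.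
    rewrite (_ : _ - a = t *: v + h *: w); first exact: le_lt_trans tri td2.
    by rewrite addrAC (addrC a) addrK addrC.
  by rewrite addrC addKr; apply: le_lt_trans td2; rewrite lerDl.
move: E; rewrite scale0r !addr0 => E.
rewrite (_ : _ - h * (h * L) = h * (dv (a + c *: v + h *: w) - dv (a + c *: v) - h * L)).
  have cd1 : `|a + c *: v - a| < d1.
    rewrite addrC addKr; have := hv _ ch; rewrite lt_min => /andP[+ _].
    by apply: le_lt_trans; rewrite lerDl.
  have hd1 : `|h| < d1.
    move: hs; rewrite lt_min => /andP[+ _]; apply: le_lt_trans.
    by rewrite ler_peMr // lerDr addr_ge0.
  rewrite normrM (_ : e * (h * h) = `|h| * (e * `|h|)) ?ler_wpM2l ?d1P //.
  by rewrite [RHS]mulrCA -normrM ger0_norm // -expr2 sqr_ge0.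
rewrite mulrBr (_ : a + c *: v + h *: w = a + h *: w + c *: v); last by rewrite addrAC.
by rewrite -E; ring.
Unshelve. all: by end_near. Qed.

(** The second difference is symmetric in [v] and [w]; divided by [h ^ 2] it tends to both [L] and
    [M]. *)
Lemma schwarz k (F dv dw : 'rV[R]_k -> R) (a v w : 'rV[R]_k) (L M : R) :
  (\forall y \near a, is_derive y v F (dv y)) ->
  (\forall y \near a, is_derive y w F (dw y)) ->
  strict_deriv dv a w L -> strict_deriv dw a v M -> L = M.
Proof.
move=> dF dF' sv sw; apply/eqP; rewrite -subr_eq0 -normr_eq0 eq_le normr_ge0 andbT.
apply/ler_addgt0Pl => e e0; rewrite addr0.
have e20 : 0 < e / 2 by rewrite divr_gt0.
have n1 := second_difference dF sv e20; have n2 := second_difference dF' sw e20.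
have : \forall h \near 0^'+, h * h * `|L - M| <= e * (h * h).
  near=> h.
  have l1 : `|F (a + h *: w + h *: v) - F (a + h *: w) - F (a + h *: v) + F a - h * (h * L)|
      <= e / 2 * (h * h) by near: h; apply: cvg_within.
  have l2 : `|F (a + h *: v + h *: w) - F (a + h *: v) - F (a + h *: w) + F a - h * (h * M)|
      <= e / 2 * (h * h) by near: h; apply: cvg_within.
  have hh : 0 <= h * h by rewrite -expr2 sqr_ge0.
  rewrite -{1}(ger0_norm hh) -normrM.
  move: l1 l2; rewrite (addrAC a (h *: v)); set A := F (_ + _ + _).
  move=> l1 l2; rewrite -normrN.
  rewrite [X in `|X| <= _](_ : _ = (A - F (a + h *: w) - F (a + h *: v) + F a - h * (h * L)) -
     (A - F (a + h *: v) - F (a + h *: w) + F a - h * (h * M))); last by ring.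
  rewrite (le_trans (ler_normB _ _)) //.
  rewrite (_ : e * (h * h) = e / 2 * (h * h) + e / 2 * (h * h)); last by field.
  exact: lerD.
move=> nr; near (0 : R)^'+ => h.
have h0 : 0 < h by near: h; apply: nbhs_right_gt.
have : h * h * `|L - M| <= e * (h * h) by near: h.
by rewrite mulrC ler_pM2r // mulr_gt0.
Unshelve. all: by end_near. Qed.

(** If [L > 0], then [dg] is positive just to the right of 0, and [g] exceeds [g 0] there by the
    mean value theorem. *)
Lemma second_derivative_test (g dg : R -> R) (L : R) :
  (\forall t \near (0 : R), is_derive (t : R) 1 g (dg t)) -> is_derive (0 : R) 1 dg L ->
  (\forall t \near (0 : R), g t <= g 0) -> dg 0 = 0 /\ L <= 0.
Proof.
move=> ng ddg nmax.
have /nbhs_ballP[d /= d0 dP] : \forall t \near (0 : R), is_derive (t : R) 1 g (dg t) /\ g t <= g 0.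
  exact: filterI ng nmax.
have dg0 : dg 0 = 0.
  have oo t : t \in `](- d), d[ -> is_derive (t : R) 1 g (dg t) /\ g t <= g 0.
    rewrite in_itv /= => /andP[t1 t2]; apply: dP.
    by rewrite -ball_normE /= sub0r normrN ltr_norml t1.
  have i0 : 0 \in `](- d), d[ by rewrite in_itv /= oppr_lt0 d0.
  have dd : - d <= d by lra.
  have dm : is_derive (0 : R) (1 : R) g 0.
    apply: (derive1_at_max dd _ i0) => t /oo[] // [].
  have [[_ <-] _] := oo _ i0; by case: dm.
split => //; rewrite leNgt; apply/negP => L0.
have [d1 d2] := ddg.
have cv : h^-1 * dg h @[h --> 0^'] --> L.
  rewrite -d2 /derive; apply: cvg_trans d1; apply: near_eq_cvg; near=> h.
  by rewrite /= dg0 subr0 [h *: 1]mulr1 addr0.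
have /nbhs_ballP[r /= r0 rP] : \forall h \near 0^', 0 < h^-1 * dg h.
  exact: (cvgr_gt L cv).
pose h := Num.min r d / 2.
have m0 : 0 < Num.min r d by rewrite lt_min r0.
have h0 : 0 < h by rewrite divr_gt0.
have hlt : h < Num.min r d by rewrite /h; move: (Num.min r d) m0 => x x0; lra.
have [hr hd] : h < r /\ h < d by move: hlt; rewrite lt_min => /andP.
have [t tI||c cI E] := @MVT R g dg 0 h h0.
- move: tI; rewrite in_itv /= => /andP[t0 th].
  have tb : ball (0 : R) d t.
    by rewrite -ball_normE /= sub0r normrN gtr0_norm //; exact: lt_trans th hd.
  by have [] := dP t tb.
- apply: derivable_within_continuous => t; rewrite in_itv /= => /andP[t0 th].
  have tb : ball (0 : R) d t.
    by rewrite -ball_normE /= sub0r normrN ger0_norm // (le_lt_trans th hd).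
  by have [[]] := dP t tb.
move: cI; rewrite in_itv /= => /andP[c0 ch].
have : 0 < c^-1 * dg c.
  apply: rP; last by rewrite gt_eqF.
  by rewrite -ball_normE /= sub0r normrN gtr0_norm // (lt_trans ch).
rewrite pmulr_rgt0 ?invr_gt0 // => dgc.
have [_] : is_derive h (1 : R) g (dg h) /\ g h <= g 0.
  by apply: dP; rewrite -ball_normE /= sub0r normrN gtr0_norm.
by rewrite -subr_le0 E subr0 leNgt mulr_gt0.
Unshelve. all: by end_near. Qed.

(** Continuity of the next partials makes coordinate directions strict; linearity gives the
    others. *)
Lemma Ck_strict_deriv k N (U : set 'rV[R]_k) (F : 'rV[R]_k -> R) s a v :
  Ck_on N U F -> (size s < N)%N -> U a ->
  strict_deriv (iter_partial s F) a v (\sum_i v 0 i * iter_partial (i :: s) F a).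
Proof.
move=> [oU CF] sN Ua; rewrite [v in strict_deriv _ _ v](row_sum_delta v).
apply: (big_ind2 (fun x L => strict_deriv (iter_partial s F) a x L)) => //.
- exact: strict_deriv0.
- by move=> *; apply: strict_derivD.
move=> i _; apply: strict_derivZ.
apply: (@strict_deriv_partial _ _ _ a _ (iter_partial (i :: s) F)).
  apply: filterS (open_nbhs_nbhs (conj oU Ua)) => y Uy.
  by have [_ /(_ sN y Uy i) dy] := CF s (ltnW sN); apply: DeriveDef.
by have [/(_ a Ua)] := CF (i :: s) sN.
Qed.

End SecondOrder.

(** * Hyperbolic functions *)

Section Hyperbolic.
Variable R : realType.

Lemma sinh_gt0 (t : R) : 0 < t -> 0 < sinh t.
Proof. by move=> t0; rewrite divr_gt0 // subr_gt0 ltr_expR; lra. Qed.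

Lemma cosh_lt (s t : R) : 0 < s -> s < t -> cosh s < cosh t.
Proof.
move=> s0 st; rewrite /cosh ltr_pM2r ?invr_gt0 // !expRN.
have x1 : 1 < expR s by rewrite expR_gt1.
have xy : expR s < expR t by rewrite ltr_expR.
move: (expR s) (expR t) x1 xy => x y x1 xy.
have x0 : 0 < x by lra.
have y0 : 0 < y by lra.
rewrite -subr_gt0.
have -> : y + y^-1 - (x + x^-1) = (y - x) * (x * y - 1) / (x * y).
  by field; rewrite !gt_eqF.
rewrite divr_gt0 ?mulr_gt0 ?subr_gt0 //.
by rewrite -[ltLHS]mulr1 ltr_pM // ?ler01 //; lra.
Qed.

Lemma is_derive_sinh (t : R) : is_derive t 1 (@sinh R) (cosh t).
Proof.
have -> : @sinh R = 2^-1 *: (expR - (expR \o -%R)).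
  by apply/funext => x; rewrite /sinh /GRing.scale /= mulrC.
apply: is_derive_eq; rewrite /cosh /GRing.scale /= mulrC; congr (_ / _).
by rewrite mulrN1 opprK.
Qed.

(* This is [ln (tanh (t / 2))], the coordinate in which the metric becomes
   [sinh^2 (dv^2 + e)], conformal to a cylinder. *)
Definition cyl (t : R) : R := ln (expR t - 1) - ln (expR t + 1).

Lemma is_derive_cyl (t : R) : 0 < t -> is_derive t 1 cyl (sinh t)^-1.
Proof.
move=> t0; have x1 : 1 < expR t by rewrite expR_gt1.
have d1 : is_derive (expR t - 1) 1 (@ln R) (expR t - 1)^-1.
  by apply: is_derive1_ln; rewrite subr_gt0.
have d2 : is_derive (expR t + 1) 1 (@ln R) (expR t + 1)^-1.
  by apply: is_derive1_ln; rewrite addr_gt0 // expR_gt0.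
have e1 : is_derive t 1 (fun t : R => expR t - 1) (expR t).
  by apply: is_derive_eq; rewrite subr0.
have e2 : is_derive t 1 (fun t : R => expR t + 1) (expR t).
  by apply: is_derive_eq; rewrite addr0.
have -> : cyl = ((@ln R \o (fun t => expR t - 1)) - (@ln R \o (fun t => expR t + 1))).
  exact/funext.
have dd := is_deriveB (is_derive1_comp (g := fun t => expR t - 1) d1 e1)
  (is_derive1_comp (g := fun t => expR t + 1) d2 e2).
apply: (is_derive_eq dd).
rewrite /sinh expRN; move: (expR t) x1 => x x1.
have h1 : x - 1 != 0 by rewrite gt_eqF // subr_gt0.
have h2 : x + 1 != 0 by rewrite gt_eqF //; lra.
have h3 : x * x - 1 != 0.
  by rewrite (_ : x * x - 1 = (x - 1) * (x + 1)) ?mulf_neq0 //; ring.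
by field; rewrite h1 h2 h3 gt_eqF //; lra.
Qed.

Lemma cyl_lt (s t : R) : 0 < s -> s < t -> cyl s < cyl t.
Proof.
move=> s0 st; have x1 : 1 < expR s by rewrite expR_gt1.
have xy : expR s < expR t by rewrite ltr_expR.
rewrite /cyl; move: (expR s) (expR t) x1 xy => x y x1 xy.
rewrite -!ln_div ?posrE ?ltr_ln ?posrE ?divr_gt0 //; try lra.
rewrite ltr_pdivrMr; last by lra.
rewrite mulrAC ltr_pdivlMr; last by lra.
nra.
Qed.

Lemma is_derive_cyl_comp (Z dZ : R -> R) (t : R) :
  0 < Z t -> is_derive t 1 Z (dZ t) ->
  is_derive t 1 (fun s => cyl (Z s)) (dZ t / sinh (Z t)).
Proof.
move=> Z0 dz; apply: (is_derive_eq (is_derive1_comp (is_derive_cyl Z0) dz)).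
by rewrite mulrC.
Qed.

(** The second derivative of [cyl Z]; its [cosh] term is the source of the correction [- c p^T p] to
    the Hessian. *)
Lemma is_derive2_cyl_comp (Z dZ : R -> R) (d2Z : R) (t : R) :
  0 < Z t -> is_derive t 1 Z (dZ t) -> is_derive t 1 dZ d2Z ->
  is_derive t 1 (fun s => dZ s / sinh (Z s))
    (d2Z / sinh (Z t) - cosh (Z t) * (dZ t / sinh (Z t)) ^+ 2).
Proof.
move=> Z0 dz d2z.
have s0 : sinh (Z t) != 0 by rewrite gt_eqF // sinh_gt0.
have dsz := is_derive1_comp (is_derive_sinh (Z t)) dz.
have dV := is_deriveV (f := @sinh R \o Z) s0 dsz.
apply: (is_derive_eq (is_deriveM d2z dV)).
by rewrite /GRing.scale /=; field.
Qed.

End Hyperbolic.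

(** * Functions on the sphere *)

Section Sphere.
Variables (R : realType) (k : nat).
Implicit Types (u x : 'rV[R]_k) (z : 'rV[R]_k -> R).

Lemma enormZ c x : 0 <= c -> enorm (c *: x) = c * enorm x.
Proof.
move=> c0; rewrite /enorm.
have -> : edot (c *: x) (c *: x) = c ^+ 2 * edot x x.
  by rewrite /edot mulr_sumr; apply: eq_bigr => i _; rewrite !mxE; ring.
by rewrite sqrtrM ?sqr_ge0 // sqrtr_sqr ger0_norm.
Qed.

Lemma enorm_gt0 x : x != 0 -> 0 < enorm x.
Proof.
move=> x0; rewrite sqrtr_gt0 lt_def edot_ge0 andbT.
by apply: contraNneq x0 => /edot_eq0 ->.
Qed.

Lemma sphere_enorm u : sphere u -> enorm u = 1.
Proof. by rewrite /sphere /= /enorm => ->; rewrite sqrtr1. Qed.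

Lemma sphere_neq0 u : sphere u -> u != 0.
Proof.
move=> su; apply/eqP => u0; have := sphere_enorm su.
rewrite u0 -(scale0r 0) enormZ // mul0r => /eqP.
by rewrite eq_sym oner_eq0.
Qed.

Lemma sphere_normalize x : x != 0 -> sphere ((enorm x)^-1 *: x).
Proof.
move=> x0; have e0 := enorm_gt0 x0.
have -> : forall y : 'rV[R]_k, sphere y = (enorm y ^+ 2 = 1).
  by move=> y; rewrite /enorm sqr_sqrtr ?edot_ge0.
by rewrite enormZ ?invr_ge0 1?ltW // mulVf ?gt_eqF // expr1n.
Qed.

Lemma hext_sphere z u : sphere u -> hext z u = z u.
Proof. by move=> su; rewrite /hext sphere_enorm // invr1 scale1r. Qed.

Lemma hextZ z c x : 0 < c -> hext z (c *: x) = hext z x.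
Proof.
move=> c0; rewrite /hext enormZ ?ltW // scalerA invfM mulrAC mulVf ?gt_eqF //.
by rewrite mul1r.
Qed.

Lemma sphere_compact : compact (@sphere R k).
Proof.
apply: bounded_closed_compact.
  exists 1; split; first exact: num_real.
  (* The norm on row vectors is the maximum norm, so coordinates are bounded one by one. *)
  move=> y y1 u su /=; rewrite [leLHS]/Num.norm /= mx_normrE.
  apply/bigmax_leP; split; first by rewrite ltW // (lt_trans ltr01).
  move=> [i j] _ /=; rewrite ord1 (le_trans _ (ltW y1)) //.
  rewrite -(ler_pXn2r (n := 2)) ?nnegrE // expr1n real_normK ?num_real //.
  rewrite -(su : edot u u = 1) /edot (bigD1 j) //= -expr2 lerDl.
  by apply: sumr_ge0 => h _; rewrite -expr2 sqr_ge0.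
have ce : continuous (fun u : 'rV[R]_k => edot u u).
  rewrite /edot; elim: (index_enum _) => [|i s IH] u.
    by under eq_fun do rewrite big_nil; apply: cst_continuous.
  under eq_fun do rewrite big_cons.
  have ci := @coord_continuous R 1 k 0 i u.
  exact: cvgD (cvgM ci ci) (IH u).
rewrite (_ : @sphere R k = (fun u => edot u u) @^-1` [set 1]); last by [].
by move/continuous_closedP: ce; apply; apply: closed_eq.
Qed.

Section C2.
Variables (z : 'rV[R]_k -> R) (zC2 : C2_sphere z).

Lemma C2_is_derive y x : y != 0 ->
  is_derive y x (hext z) (edot x (sgrad z y)).
Proof.
move=> y0; apply: strict_deriv_is_derive.
rewrite (_ : edot x _ = \sum_i x 0 i * iter_partial [:: i] (hext z) y).
  exact: (Ck_strict_deriv (s := [::]) _ zC2).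
by apply: eq_bigr => i _; rewrite mxE.
Qed.

Lemma hext_continuous y : y != 0 -> {for y, continuous (hext z)}.
Proof. by move=> y0; have [_ /(_ [::] isT) [/(_ y y0)]] := zC2. Qed.

Lemma C2_is_derive2 y x : y != 0 ->
  is_derive y x (fun y => edot x (sgrad z y)) ((x *m shess z y *m x^T) 0 0).
Proof.
move=> y0.
have -> : (fun y => edot x (sgrad z y)) =
    \sum_(i < k) (x 0 i *: iter_partial [:: i] (hext z)).
  by apply/funext => v; rewrite fct_sumE /edot; apply: eq_bigr => i _; rewrite mxE.
apply: (@is_derive_eq _ _ _ _ _ _ _ (\sum_i x 0 i *: (\sum_j x 0 j *: shess z y i j))).
  apply: is_derive_sum => i; apply: is_deriveZ.
  apply: strict_deriv_is_derive.
  rewrite (_ : \sum_j _ = \sum_j x 0 j * iter_partial [:: j; i] (hext z) y).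
    exact: (Ck_strict_deriv (s := [:: i]) _ zC2).
  by apply: eq_bigr => j _; rewrite mxE.
rewrite mxE.
under [RHS]eq_bigr do rewrite !mxE mulr_suml.
rewrite exchange_big /=; apply: eq_bigr => i _; rewrite scaler_sumr.
by apply: eq_bigr => j _; rewrite /GRing.scale /=; ring.
Qed.

Lemma shess_sym (y : 'rV[R]_k) : y != 0 -> (shess z y)^T = shess z y.
Proof.
move=> y0; apply/matrixP => i j; rewrite !mxE.
have nz : \forall x \near y, (x : 'rV[R]_k) != 0.
  by have [oU _] := zC2; exact: open_nbhs_nbhs (conj oU y0).
have d1 a : \forall x \near y, is_derive x (ebase R a) (hext z) (derive (hext z) x (ebase R a)).
  apply: filterS nz => x x0.
  have [_ /(_ [::] isT) [_ /(_ isT x x0 a) dx]] := zC2.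
  exact: DeriveDef.
have sd a b : strict_deriv (iter_partial [:: a] (hext z)) y (ebase R b)
    (iter_partial [:: b; a] (hext z) y).
  have := Ck_strict_deriv (s := [:: a]) (ebase R b) zC2 isT y0.
  rewrite (bigD1 b) //= big1 ?addr0; last first.
    by move=> c cb; rewrite /ebase mxE eqxx (negPf cb) mul0r.
  by rewrite /ebase mxE !eqxx mul1r.
exact: (schwarz (d1 j) (d1 i) (sd j i) (sd i j)).
Qed.

(** [hext z] is constant along the ray through [u]. *)
Lemma edot_sgrad u : sphere u -> edot u (sgrad z u) = 0.
Proof.
move=> su; have [_ <-] := C2_is_derive u (sphere_neq0 su).
apply/cvg_lim => //; apply: cvg_trans (near_eq_cvg _) (cvg_cst 0); near=> h.
have h1 : `|h| < 1 by near: h; apply: dnbhs0_lt.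
have h0 : 0 < 1 + h by move: h1; rewrite ltr_norml => /andP[? _]; lra.
by rewrite /= (_ : h *: u + u = (1 + h) *: u) ?hextZ ?subrr ?scaler0 //
  scalerDl scale1r addrC.
Unshelve. all: by end_near. Qed.

End C2.
End Sphere.

(** * Comparison at a maximum point *)

Section Critical.
Variables (R : realType) (k : nat) (z1 z2 : 'rV[R]_k -> R).
Hypotheses (z1C2 : C2_sphere z1) (z2C2 : C2_sphere z2).
Hypotheses (z1_gt0 : forall u, sphere u -> 0 < z1 u)
           (z2_gt0 : forall u, sphere u -> 0 < z2 u).

Let f (u : 'rV[R]_k) := cyl (hext z1 u) - cyl (hext z2 u).

Lemma cyl_continuous (t : R) : 0 < t -> {for t, continuous (@cyl R)}.
Proof.
move=> t0; have [d _] := is_derive_cyl t0.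
exact/differentiable_continuous/derivable1_diffP.
Qed.

Lemma cyl_max_exists (v : 'rV[R]_k) : sphere v ->
  exists2 u : 'rV[R]_k, sphere u & forall w, sphere w -> f w <= f u.
Proof.
move=> sv.
have [|u] := @EVT_max_rV R k f (@sphere R k) (ex_intro _ v sv) (@sphere_compact R k).
  apply: continuous_in_subspaceT => u; rewrite inE => su.
  have u0 := sphere_neq0 su.
  have c1 : {for u, continuous (fun w => cyl (hext z1 w))}.
    apply: continuous_comp; first exact: hext_continuous.
    by apply: cyl_continuous; rewrite hext_sphere // z1_gt0.
  have c2 : {for u, continuous (fun w => cyl (hext z2 w))}.
    apply: continuous_comp; first exact: hext_continuous.
    by apply: cyl_continuous; rewrite hext_sphere // z2_gt0.
  exact: cvgB c1 c2.
rewrite inE => su max; exists u => // w sw; apply: max; rewrite inE; exact: sw.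
Qed.

Variable u : 'rV[R]_k.
Hypotheses (su : sphere u) (umax : forall w, sphere w -> f w <= f u).

(** [hext] is homogeneous of degree 0, so a maximum over the sphere is one over all nonzero points.
    Straight lines [u + t *: x] can therefore serve as test curves, for every [x], tangent or
    not. *)
Lemma cyl_critical x :
  edot x (sgrad z1 u) / sinh (z1 u) = edot x (sgrad z2 u) / sinh (z2 u) /\
  (x *m shess z1 u *m x^T) 0 0 / sinh (z1 u) -
    cosh (z1 u) * (edot x (sgrad z1 u) / sinh (z1 u)) ^+ 2 <=
  (x *m shess z2 u *m x^T) 0 0 / sinh (z2 u) -
    cosh (z2 u) * (edot x (sgrad z2 u) / sinh (z2 u)) ^+ 2.
Proof.
have u0 := sphere_neq0 su.
have hext_gt0 z y : (forall w, sphere w -> 0 < z w) -> y != 0 -> 0 < hext z y.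
  by move=> zp y0; apply: zp; apply: sphere_normalize.
have nz : \forall t \near (0 : R), u + t *: x != 0.
  have cl : {for 0, continuous (fun t : R => u + t *: x)}.
    apply: cvgD; first exact: cvg_cst.
    by apply: cvgZl; exact: cvg_id.
  have oU : open [set y : 'rV[R]_k | y != 0] by case: z1C2.
  have nb : nbhs (u + (0 : R) *: x) [set y : 'rV[R]_k | y != 0].
    by apply: open_nbhs_nbhs; split; [exact: oU|rewrite /= scale0r addr0].
  exact: cl nb.
pose Z (z : 'rV[R]_k -> R) t := hext z (u + t *: x).
pose dZ (z : 'rV[R]_k -> R) t := edot x (sgrad z (u + t *: x)).
have D1 z t : C2_sphere z -> u + t *: x != 0 -> is_derive t (1 : R) (Z z) (dZ z t).
  by move=> zC2 t0; apply: is_derive_line; apply: C2_is_derive.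
have D2 z : C2_sphere z ->
    is_derive (0 : R) (1 : R) (dZ z) ((x *m shess z u *m x^T) 0 0).
  move=> zC2; apply: (is_derive_line (F := fun y => edot x (sgrad z y))).
  by rewrite scale0r addr0; apply: C2_is_derive2.
have Z0 z : Z z 0 = z u by rewrite /Z scale0r addr0 hext_sphere.
have dZ0 z : dZ z 0 = edot x (sgrad z u) by rewrite /dZ scale0r addr0.
have ux0 : u + 0 *: x != 0 by rewrite scale0r addr0.
pose g t := cyl (Z z1 t) - cyl (Z z2 t).
pose dg t := dZ z1 t / sinh (Z z1 t) - dZ z2 t / sinh (Z z2 t).
have [] := @second_derivative_test R g dg
  ((x *m shess z1 u *m x^T) 0 0 / sinh (Z z1 0) -
    cosh (Z z1 0) * (dZ z1 0 / sinh (Z z1 0)) ^+ 2 -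
   ((x *m shess z2 u *m x^T) 0 0 / sinh (Z z2 0) -
    cosh (Z z2 0) * (dZ z2 0 / sinh (Z z2 0)) ^+ 2)).
- apply: filterS nz => t t0; apply: is_deriveB; apply: is_derive_cyl_comp.
  + exact: hext_gt0.
  + exact: D1.
  + exact: hext_gt0.
  + exact: D1.
- apply: is_deriveB; apply: is_derive2_cyl_comp.
  + exact: hext_gt0.
  + exact: D1.
  + exact: D2.
  + exact: hext_gt0.
  + exact: D1.
  + exact: D2.
- apply: filterS nz => t t0.
  have := umax (sphere_normalize t0).
  have eZ z : hext z ((enorm (u + t *: x))^-1 *: (u + t *: x)) = Z z t.
    by rewrite hextZ // invr_gt0 enorm_gt0.
  by rewrite /f !eZ !(hext_sphere _ su) -!Z0.
by rewrite /dg !Z0 !dZ0 subr_le0 => /eqP; rewrite subr_eq0 => /eqP.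
Qed.

Lemma critical_gradient :
  (sinh (z1 u))^-1 *: sgrad z1 u = (sinh (z2 u))^-1 *: sgrad z2 u.
Proof.
apply/rowP => i; rewrite mxE [RHS]mxE.
have delta_edot (v : 'rV[R]_k) : edot (delta_mx 0 i) v = v 0 i.
  rewrite /edot (bigD1 i) //= mxE !eqxx mul1r big1 ?addr0 // => j ji.
  by rewrite mxE eqxx (negPf ji) mul0r.
have [+ _] := cyl_critical (delta_mx 0 i).
by rewrite !delta_edot mulrC => ->; rewrite mulrC.
Qed.

Lemma critical_hessian (p : 'rV[R]_k := (sinh (z2 u))^-1 *: sgrad z2 u)
    (x : 'rV[R]_k) :
  (x *m ((sinh (z1 u))^-1 *: shess z1 u - cosh (z1 u) *: (p^T *m p)) *m x^T) 0 0 <=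
  (x *m ((sinh (z2 u))^-1 *: shess z2 u - cosh (z2 u) *: (p^T *m p)) *m x^T) 0 0.
Proof.
have [e le] := cyl_critical x.
have xp : edot x (sgrad z2 u) / sinh (z2 u) = edot x p.
  by rewrite /edot mulr_suml; apply: eq_bigr => i _; rewrite [p 0 i]mxE; ring.
clearbody p.
have entryB (A B : 'M[R]_1) c d : (c *: A - d *: B) 0 0 = c * A 0 0 - d * B 0 0.
  by rewrite !mxE.
have quad a c (A : 'M[R]_k) : (x *m (a *: A - c *: (p^T *m p)) *m x^T) 0 0 =
    (x *m A *m x^T) 0 0 * a - c * edot x p ^+ 2.
  have xpx : x *m (p^T *m p) *m x^T = (edot x p ^+ 2)%:M.
    by rewrite mulmxA -(mulmxA (x *m p^T)) !edotE -scalar_mxM (edotC p x) expr2.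
  rewrite mulmxBr mulmxBl -!scalemxAr -!scalemxAl xpx entryB.
  by rewrite [_%:M 0 0]mxE eqxx mulr1n mulrC.
by rewrite e in le; rewrite !quad -xp.
Qed.

End Critical.

(** Dividing the gradient by [sinh z] gives the gradient of [cyl z]; the square root in [fund2]
    becomes [s * slope p]. *)
Lemma fund_formE (R : realType) n (z : 'rV[R]_n.+1 -> R) (u : 'rV[R]_n.+1)
    (s := sinh (z u)) (p : 'rV[R]_n.+1 := s^-1 *: sgrad z u) : 0 < s ->
  fund1 z u + u^T *m u = s ^+ 2 *: tproj u + s ^+ 2 *: (p^T *m p) + u^T *m u /\
  fund2 z u = (s / slope p) *: curv_mx u p (cosh (z u)) (s^-1 *: shess z u).
Proof.
move=> s0; have s0' : s != 0 by rewrite gt_eqF.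
have gE : sgrad z u = s *: p by rewrite scalerA divff // scale1r.
clearbody p.
have TE : (sgrad z u)^T *m sgrad z u = s ^+ 2 *: (p^T *m p).
  have trZ : (s *: p)^T = s *: p^T by rewrite linearZ.
  by rewrite gE trZ -scalemxAl -scalemxAr scalerA expr2.
split; first by rewrite /fund1 TE.
have W0 := slope_gt0 p.
have wE : Num.sqrt (s ^+ 2 + edot (sgrad z u) (sgrad z u)) = s * slope p.
  have -> : edot (sgrad z u) (sgrad z u) = s ^+ 2 * edot p p.
    by rewrite gE /edot mulr_sumr; apply: eq_bigr => i _; rewrite !mxE; ring.
  by rewrite -[X in X + _]mulr1 -mulrDr sqrtrM ?sqr_ge0 // sqrtr_sqr gtr0_norm.
rewrite /fund2 -/s TE wE /curv_mx.
move: (tproj u) (shess z u) (p^T *m p) => P Hs T.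
rewrite -scalemxAr -scalemxAl !scalerDr !scalerN !scalerA.
congr (- (_ *: _) + _ *: _ + _ *: _); field; rewrite !gt_eqF //.
Qed.

(** * Radial monotonicity and uniqueness *)

Section Uniqueness.
Variables (R : realType) (n m : nat) (R1 R2 : R) (psi : 'rV[R]_n.+1 -> R -> R).
Hypotheses (n1 : (1 <= n)%N) (mn : (1 <= m <= n)%N).
Hypothesis psiC : exists U : set 'rV[R]_(n.+1 + 1), @Omega_bar R n R1 R2 `<=` U /\
      smooth_on U (fun p => psi (lsubmx p) (rsubmx p 0 0)).
Hypothesis psi' : forall u r, sphere u -> R1 <= r <= R2 ->
      derive1 (fun t => psi u t * sinh t ^+ m) r <= 0.

(** The radial derivative is the last partial derivative of the smooth extension. *)
Lemma psi_derivable u r : sphere u -> R1 <= r <= R2 -> derivable (psi u) r 1.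
Proof.
move=> su rI; have [U [OU smooth]] := psiC.
have [_ /(_ [::] isT) [_ /(_ isT)]] := smooth 1%N.
have pU : U (row_mx u (const_mx r)) by apply: OU; exists u, r.
move=> /(_ _ pU (rshift n.+1 (ord0 : 'I_1))) /= d.
have rowE t : row_mx u 0 + t *: ebase R (rshift n.+1 (ord0 : 'I_1)) = row_mx u (const_mx t).
  apply/rowP => j; rewrite !mxE eqxx /=.
  case: (@splitP n.+1 1 j) => i ji; rewrite ?mxE.
    rewrite (_ : j == _ = false) ?mulr0 ?addr0 //.
    by apply/eqP => /(congr1 val) /=; rewrite ji addn0 => i_n; have := ltn_ord i; rewrite i_n ltnn.
  rewrite (_ : j == _ = true) ?mulr1 ?add0r //.
  by apply/eqP/val_inj => /=; rewrite ji (ord1 i).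
pose F (p : 'rV[R]_(n.+1 + 1)) := psi (lsubmx p) (rsubmx p 0 0).
have -> : psi u = (fun t => F (row_mx u 0 + t *: ebase R (rshift n.+1 (ord0 : 'I_1)))).
  by apply/funext => t; rewrite rowE /F row_mxKl row_mxKr mxE.
have : is_derive (row_mx u (const_mx r)) (ebase R (rshift n.+1 (ord0 : 'I_1))) F
  (derive F (row_mx u (const_mx r)) (ebase R (rshift n.+1 (ord0 : 'I_1)))) by exact: DeriveDef.
by rewrite -rowE => /is_derive_line [].
Qed.

(** [psi_derivable] makes the total operator [derive1] a genuine derivative, to which the mean value
    theorem applies. *)
Lemma psi_sinh_nonincreasing u r s : sphere u -> R1 <= r -> r <= s -> s <= R2 ->
  psi u s * sinh s ^+ m <= psi u r * sinh r ^+ m.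
Proof.
move=> su rR rs sR.
pose f t := psi u t * sinh t ^+ m.
have fd (t : R) : R1 <= t <= R2 -> is_derive t (1 : R) f (derive1 f t).
  move=> tI; rewrite derive1E; apply: DeriveDef => //.
  apply: derivableM; first exact: psi_derivable.
  have -> : (fun t => sinh t ^+ m) = (@sinh R) ^+ m.
    by apply/funext => x; rewrite exprfctE.
  by apply: derivableX; have [] := is_derive_sinh t.
have inI (t : R) : r <= t <= s -> R1 <= t <= R2.
  by case/andP => rt ts; rewrite (le_trans rR rt) (le_trans ts sR).
have [t tI||c cI E] := @MVT_segment R f (derive1 f) r s rs.
- apply: fd; apply: inI; move: tI; rewrite in_itv /= => /andP[rt ts].
  by rewrite !ltW.
- by apply: derivable_within_continuous => t /inI/fd [].
rewrite -subr_le0 -/(f s) -/(f r) E mulr_le0_ge0 ?subr_ge0 //.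
exact: psi' su (inI _ cI).
Qed.

(* At a maximum of [cyl z1 - cyl z2] the two graphs share gradient data and
   [z1] has the larger curvature matrix, so [z1 > z2] there would force
   [H_m] of the first graph, rescaled by [sinh^m], to be the larger one. *)
Lemma solution_le z1 z2 : C2_sphere z1 -> C2_sphere z2 ->
  m_admissible m z1 -> m_admissible m z2 ->
  (forall u, sphere u -> R1 <= z1 u <= R2) ->
  (forall u, sphere u -> R1 <= z2 u <= R2) ->
  (forall u, sphere u -> forall lam, principal_curvatures z1 u lam ->
      Hm m lam = psi u (z1 u)) ->
  (forall u, sphere u -> forall lam, principal_curvatures z2 u lam ->
      Hm m lam = psi u (z2 u)) ->
  forall u, sphere u -> z1 u <= z2 u.
Proof.
move=> C1 C2 [z1_gt0 _] [z2_gt0 adm2] z1I z2I eq1 eq2 v sv.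
rewrite leNgt; apply/negP => v21.
have [u su umax] := cyl_max_exists C1 C2 z1_gt0 z2_gt0 sv.
(* Otherwise the maximum of [cyl z1 - cyl z2] would be nonpositive, while its value at [v] is
   positive. *)
have u12 : z2 u < z1 u.
  rewrite ltNge; apply/negP => u12.
  have := umax v sv; rewrite leNgt => /negP; apply.
  rewrite !hext_sphere //.
  have l1 : cyl (z2 v) < cyl (z1 v) by apply: cyl_lt => //; apply: z2_gt0.
  have l2 : cyl (z1 u) <= cyl (z2 u).
    move: u12; rewrite le_eqVlt => /orP[/eqP -> //|u12].
    by rewrite ltW // cyl_lt // z1_gt0.
  by rewrite (le_lt_trans (y := 0)) ?subr_le0 ?subr_gt0.
have [z1u z2u] := (z1_gt0 u su, z2_gt0 u su).
have [s1 s2] := (sinh_gt0 z1u, sinh_gt0 z2u).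
have u0 := sphere_neq0 su.
have grad := critical_gradient C1 C2 z1_gt0 z2_gt0 su umax.
have hess := critical_hessian C1 C2 z1_gt0 z2_gt0 su umax.
have [g1 h1] := fund_formE s1; have [g2 h2] := fund_formE s2.
(* Both graphs now share [p], hence [slope p] and [isqrt_mx p]; their curvature matrices differ only
   in the [cosh] and Hessian terms. *)
rewrite grad in g1 h1; set p := _ *: sgrad z2 u in g1 h1 g2 h2 hess.
have up : edot u p = 0.
  rewrite -(mulr0 (sinh (z2 u))^-1) -(edot_sgrad C2 su) /edot mulr_sumr.
  by apply: eq_bigr => i _; rewrite [p 0 i]mxE; ring.
have uu : edot u u = 1 by [].
have sY z : C2_sphere z -> ((sinh (z u))^-1 *: shess z u)^T = (sinh (z u))^-1 *: shess z u.
  by move=> zC; rewrite linearZ /= (shess_sym zC u0).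
have [l1 [pc1 e1]] := curvature_eigenvalues uu up (cosh (z1 u)) s1 (sY _ C1).
have [l2 [pc2 e2]] := curvature_eigenvalues uu up (cosh (z2 u)) s2 (sY _ C2).
rewrite -g1 -h1 in pc1; rewrite -g2 -h2 in pc2.
have H1 := eq1 u su l1 pc1; have H2 := eq2 u su l2 pc2.
have W0 := slope_gt0 p.
case/andP: mn => m0 mn'.
(* The comparison starts from the smaller matrix, that of [z2], so positivity comes from its
   admissibility. *)
have pos j : (j <= m)%N -> 0 < ecoef (isqrt_mx p *m
    curv_mx u p (cosh (z2 u)) ((sinh (z2 u))^-1 *: shess z2 u) *m isqrt_mx p) j.
  move=> jm; rewrite e2; apply: mulr_gt0; first by rewrite exprn_gt0 // mulr_gt0.
  rewrite sigma_m_elem_sym.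
  exact: Gamma_elem_sym_gt0 mn' (adm2 u su l2 pc2) _ jm.
have eq_lt (a b c d : R) : a = c -> b = d -> a < b -> c < d by move=> -> ->.
have := eq_lt _ _ _ _ (e2 m) (e1 m)
  (curv_ecoef_lt uu up n1 m0 (sY _ C1) (sY _ C2) (cosh_lt z2u u12) hess pos).
have C0 : 0 < 'C(n, m)%:R :> R by rewrite ltr0n bin_gt0.
have sigmaE (l : 'rV[R]_n) : sigma_m m l = Hm m l * 'C(n, m)%:R.
  by rewrite /Hm mulfVK // gt_eqF.
(* Each side is [slope p ^ m] times ['C(n, m)] times [psi sinh^m] at its own height, so the strict
   inequality contradicts radial monotonicity. *)
rewrite (sigmaE l1) (sigmaE l2) H1 H2; apply/negP; rewrite -leNgt.
have /andP[_ z1R] := z1I u su; have /andP[R1z _] := z2I u su.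
have := psi_sinh_nonincreasing su R1z (ltW u12) z1R => le.
have Wm : 0 < slope p ^+ m by rewrite exprn_gt0.
have swap (a b c d : R) : a * b * (c * d) = c * a * (b * d) by ring.
move: (sinh (z1 u)) (sinh (z2 u)) (psi u (z1 u)) (psi u (z2 u)) le => x1 x2 y1 y2 le.
by rewrite !exprMn (swap (x1 ^+ m)) (swap (x2 ^+ m)) ler_pM2r // mulr_gt0.
Qed.

End Uniqueness.

Theorem theorem1p2 (R : realType) (n m : nat) (R1 R2 : R)
    (psi : 'rV[R]_n.+1 -> R -> R) (z1 z2 : 'rV[R]_n.+1 -> R) :
  (1 <= n)%N -> (1 <= m <= n)%N ->
  0 < R1 -> R1 < R2 ->
  (* psi is (the restriction of) a smooth function near Omega-bar *)
  (exists U : set 'rV[R]_(n.+1 + 1), @Omega_bar R n R1 R2 `<=` U /\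
      smooth_on U (fun p => psi (lsubmx p) (rsubmx p 0 0))) ->
  (forall u r, sphere u -> R1 <= r <= R2 -> 0 < psi u r) ->
  (forall u r, sphere u -> R1 <= r <= R2 ->
      derive1 (fun t => psi u t * sinh t ^+ m) r <= 0) ->
  C2_sphere z1 -> C2_sphere z2 ->
  m_admissible m z1 -> m_admissible m z2 ->
  (forall u, sphere u -> R1 <= z1 u <= R2) ->
  (forall u, sphere u -> R1 <= z2 u <= R2) ->
  (forall u, sphere u -> forall lam, principal_curvatures z1 u lam ->
      Hm m lam = psi u (z1 u)) ->
  (forall u, sphere u -> forall lam, principal_curvatures z2 u lam ->
      Hm m lam = psi u (z2 u)) ->
  (exists2 c : R, 0 < c &
     forall u, sphere u -> c * tanh (z1 u / 2) = tanh (z2 u / 2)) /\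
  ((forall u r, sphere u -> R1 <= r <= R2 ->
      derive1 (fun t => psi u t * sinh t ^+ m) r < 0) ->
   forall u, sphere u -> z1 u = z2 u).
Proof.
move=> n1 mn R10 _ psiC _ psi' C1 C2 a1 a2 I1 I2 e1 e2.
have z12 u : sphere u -> z1 u = z2 u.
  by move=> su; apply/eqP; rewrite eq_le
    (solution_le n1 mn psiC psi' C1 C2 a1 a2 I1 I2 e1 e2 su)
    (solution_le n1 mn psiC psi' C2 C1 a2 a1 I2 I1 e2 e1 su).
split=> [|_ //]; exists 1 => // u su.
by rewrite mul1r z12.
Qed.
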